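(* Suppose that $F\subset\mathbb{R}^2$ is bounded. Then for each $k\in\{0,1,2\}$ the scaling exponents $\tilde s_k(F)$ and $s_k(F)$ are well defined and coincide. Similarly, $\tilde a_k(F)=a_k(F)$.
   Context: **Curvature(-direction) measures in the plane.** For closed $X\subset\mathbb{R}^2$ of positive reach (Federer) let $\mathrm{nor}\,X=\{(x,n): x\in\partial X,\ n\in S^1\cap \mathrm{Nor}(X,x)\}$, $\mathrm{Nor}(X,x)$ being the polar cone of the tangent cone of $X$ at $x$. For $\mathcal H^1$-a.e. $(x,n)\in\mathrm{nor}\,X$ there is a generalized principal curvature $\kappa(x,n)\in(-\infty,\infty]$ such that the tangent space of $\mathrm{nor}\,X$ at $(x,n)$ is spanned by the unit vector $\left(\frac{a}{\sqrt{1+\kappa^2}},\frac{\kappa a}{\sqrt{1+\kappa^2}}\right)$ (equal to $(0,a)$ if $\kappa=\infty$), $a$ a unit vector orthogonal to $n$. For Borel $\beta\subset\mathbb{R}^2\times S^1$ put $$\widetilde C_0(X,\beta)=\frac1{2\pi}\int_{\mathrm{nor}\,X}\mathbf 1_\beta\frac{\kappa}{\sqrt{1+\kappa^2}}\,d\mathcal H^1,\qquad \widetilde C_1(X,\beta)=\frac12\int_{\mathrm{nor}\,X}\mathbf 1_\beta\frac{1}{\sqrt{1+\kappa^2}}\,d\mathcal H^1$$ (for $\kappa=\infty$ the integrand factors are $1$ and $0$, respectively), and $C_k(X,A):=\widetilde C_k(X,A\times S^1)$ for Borel $A\subset\mathbb{R}^2$. For bounded $F\subset\mathbb{R}^2$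 let $F_\varepsilon=\{y:\mathrm{dist}(y,F)\le\varepsilon\}$. A value $\varepsilon>0$ is regular for $F$ if the closure $\widetilde{F_\varepsilon}$ of the complement of $F_\varepsilon$ has positive reach and $\partial F_\varepsilon$ is a Lipschitz manifold. For regular $\varepsilon$ and $k\in\{0,1\}$ put $\widetilde C_k(F_\varepsilon,\cdot):=(-1)^{1-k}\widetilde C_k(\widetilde{F_\varepsilon},\rho(\cdot))$ with $\rho(x,n)=(x,-n)$, and $C_k(F_\varepsilon,A)=\widetilde C_k(F_\varepsilon,A\times S^1)$. Put $C_2(F_\varepsilon,\cdot)=\lambda_2(F_\varepsilon\cap\cdot)$ and $\widetilde C_2(F_\varepsilon,\cdot)=\lambda_2(F_\varepsilon\cap\pi_1(\cdot))$, where $\pi_1(x,n)=x$. $C_k^{\mathrm{var}}(F_\varepsilon)$ and $\widetilde C_k^{\mathrm{var}}(F_\varepsilon)$ denote the total masses of the total variation measures of $C_k(F_\varepsilon,\cdot)$ and $\widetilde C_k(F_\varepsilon,\cdot)$ (for $k=2$ both equal $\lambda_2(F_\varepsilon)$). **Scaling exponents.** $s_k(F):=\inf\{s\ge0:\ \mathrm{ess\,lim}_{\varepsilon\to0}\,\varepsilon^{s-k}C_k^{\mathrm{var}}(F_\varepsilon)=0\}$ and $a_k(F):=\inf\{s\ge0:\ \lim_{\delta\to0}\frac1{|\ln\delta|}\int_\delta^1\varepsilon^{s-k-1}C_k^{\mathrm{var}}(F_\varepsilon)\,d\varepsilon=0\}$, with $\inf\emptyset=\infty$; $\tilde s_k(F)$,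 $\tilde a_k(F)$ are defined in the same way with $\widetilde C_k^{\mathrm{var}}(F_\varepsilon)$ in place of $C_k^{\mathrm{var}}(F_\varepsilon)$. The essential limit means the limit after discarding a Lebesgue null set of $\varepsilon$'s. These exponents are called well defined if the measures involved are defined for Lebesgue-almost all $\varepsilon>0$ (the value $\infty$ is allowed). *)

(* Defs.v *)
From mathcomp Require Import all_boot all_order all_algebra.
From mathcomp Require Import all_classical all_reals all_analysis.

Set Implicit Arguments.
Unset Strict Implicit.
Unset Printing Implicit Defensive.

Import Order.TTheory GRing.Theory Num.Theory.
Import numFieldNormedType.Exports.

Local Open Scope classical_set_scope.
Local Open Scope ring_scope.

(* The plane is [R * R] and R^2 x R^2 is [(R * R) * (R * R)], with the product
   topology and the product (Borel) sigma-algebra of the library.  The library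
   norm on products is the sup norm, so the Euclidean norms are introduced
   here; they induce the same topology and the same bounded sets. *)
Section Euclidean.
Context {R : realType}.
Implicit Types (u v : R * R) (w : (R * R) * (R * R)).

Definition dotp u v : R := u.1 * v.1 + u.2 * v.2.

Definition enorm u : R := Num.sqrt (dotp u u).

Definition enorm4 w : R := Num.sqrt (dotp w.1 w.1 + dotp w.2 w.2).

Definition unit_circle : set (R * R) := [set n | enorm n = 1].

(* [+oo] when [F] is empty *)
Definition edist_set y (F : set (R * R)) : \bar R :=
  ereal_inf [set (enorm (y - x))%:E | x in F].

Definition boundary (A : set (R * R)) : set (R * R) :=
  closure A `\` interior A.

End Euclidean.

Section Cones.
Context {R : realType}.

(* Federer's tangent cone of [A] at [a], with respect to the norm [nrm] *)
Definition tangent_cone (V : lmodType R) (nrm : V -> R) (A : set V) (a : V) :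
    set V :=
  [set u | u = 0 \/ forall e : R, 0 < e -> exists b : V,
     [/\ A b, 0 < nrm (b - a) < e
       & nrm ((nrm (b - a))^-1 *: (b - a) - (nrm u)^-1 *: u) < e]].

Implicit Types (X : set (R * R)).

Definition normal_cone X (x : R * R) : set (R * R) :=
  [set v | forall u, tangent_cone enorm X x u -> dotp u v <= 0].

Definition nor X : set ((R * R) * (R * R)) :=
  [set p | [/\ boundary X p.1, unit_circle p.2 & normal_cone X p.1 p.2]].

End Cones.

Section PositiveReach.
Context {R : realType}.
Implicit Types (X : set (R * R)).

Definition unique_nearest X : set (R * R) :=
  [set y | exists! x, X x /\ forall z, X z -> enorm (y - x) <= enorm (y - z)].

Definition reach_at X (a : R * R) : \bar R :=
  ereal_sup [set r%:E | r in [set r : R | 0 <= r /\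
    [set y | enorm (y - a) < r] `<=` unique_nearest X]].

Definition reach X : \bar R := ereal_inf [set reach_at X a | a in X].

Definition positive_reach X : Prop := closed X /\ (0 < reach X)%E.

End PositiveReach.

(* One-dimensional Lipschitz submanifold: locally, for the relative topology,
   a bi-Lipschitz image of an open subset of the line. *)
Definition lipschitz_manifold1 {R : realType} (M : set (R * R)) : Prop :=
  forall p, M p ->
    exists (U : set (R * R)) (I : set R) (phi : R -> R * R) (L : R),
      [/\ open U, U p, open I, phi @` I = M `&` U
        & 0 < L /\ forall s t, I s -> I t ->
            L^-1 * `|s - t| <= enorm (phi s - phi t) <= L * `|s - t|].

Section Hausdorff.
Context {R : realType}.
Implicit Types (A : set ((R * R) * (R * R))).
Local Open Scope ereal_scope.

(* the extra [0] gives the empty set diameter 0 *)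
Definition ediam A : \bar R :=
  ereal_sup (0 |` [set r | exists p q,
    [/\ A p, A q & r = (enorm4 (p - q)%R)%:E]]).

Definition hausdorff1_pre (delta : R) A : \bar R :=
  ereal_inf [set \sum_(i <oo) ediam (B i) |
    B in [set B : nat -> set ((R * R) * (R * R)) |
      A `<=` \bigcup_i B i /\ forall i, ediam (B i) <= delta%:E]].

(* One-dimensional Hausdorff (outer) measure on R^2 x R^2.  The integral of the
   library takes an arbitrary set function and evaluates it on Borel sets
   only, so no measure structure has to be attached to it. *)
Definition hausdorff1 A : \bar R :=
  ereal_sup [set hausdorff1_pre delta A | delta in [set delta : R | (0 < delta)%R]].

End Hausdorff.

Section Curvature.
Context {R : realType}.
Implicit Types (X : set (R * R)) (p : (R * R) * (R * R)).

Definition curvature_vector (a : R * R) (kappa : \bar R) : (R * R) * (R * R) :=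
  match kappa with
  | r%:E => let c := Num.sqrt (1 + r ^+ 2) in (c^-1 *: a, (r / c) *: a)
  | _ => (0, a)
  end.

Definition is_principal_curvature X p (kappa : \bar R) : Prop :=
  kappa <> -oo%E /\
  exists a : R * R, [/\ enorm a = 1, dotp a p.2 = 0
    & tangent_cone enorm4 (nor X) p =
      [set t *: curvature_vector a kappa | t in [set: R]]].

(* [+oo] is a dummy value at the points without a principal curvature, which
   form an [hausdorff1]-null subset of [nor X] when [X] has positive reach. *)
Definition principal_curvature X p : \bar R :=
  xget +oo%E [set kappa | is_principal_curvature X p kappa].

Definition weight0 (kappa : \bar R) : R :=
  if kappa is r%:E then r / Num.sqrt (1 + r ^+ 2) else 1.

Definition weight1 (kappa : \bar R) : R :=
  if kappa is r%:E then (Num.sqrt (1 + r ^+ 2))^-1 else 0.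

Local Open Scope ereal_scope.

(* \tilde C_k(X, beta) for a set X of positive reach; only k = 0, 1 matter *)
Definition curv_dir_reach (k : nat) X (beta : set ((R * R) * (R * R))) :
    \bar R :=
  match k with
  | 0 => ((2 * pi)^-1)%:E *
         \int[hausdorff1]_(p in nor X `&` beta)
           (weight0 (principal_curvature X p))%:E
  | _ => (2^-1)%:E *
         \int[hausdorff1]_(p in nor X `&` beta)
           (weight1 (principal_curvature X p))%:E
  end.

End Curvature.

Section ParallelSets.
Context {R : realType}.
Implicit Types (F A : set (R * R)) (beta : set ((R * R) * (R * R))).
Implicit Types (eps : R) (k : nat).

Definition parallel_set F eps : set (R * R) :=
  [set y | (edist_set y F <= eps%:E)%E].

Definition parallel_cocomplement F eps : set (R * R) :=
  closure (~` parallel_set F eps).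

Definition regular_value F eps : Prop :=
  [/\ 0 < eps, positive_reach (parallel_cocomplement F eps)
    & lipschitz_manifold1 (boundary (parallel_set F eps))].

Definition lebesgue2 : set (R * R) -> \bar R :=
  (lebesgue_measure \x lebesgue_measure)%E.

Definition reflect_normal (p : (R * R) * (R * R)) : (R * R) * (R * R) :=
  (p.1, - p.2).

(* \tilde C_k(F_eps, beta) *)
Definition curv_dir k F eps beta : \bar R :=
  if (k < 2)%N then
    (((-1) ^+ (1 - k))%:E *
       curv_dir_reach k (parallel_cocomplement F eps) (reflect_normal @` beta))%E
  else lebesgue2 (parallel_set F eps `&` (fst @` beta)).

(* C_k(F_eps, A); for k = 2 this is lebesgue2 (F_eps `&` A) *)
Definition curv k F eps A : \bar R := curv_dir k F eps (A `*` unit_circle).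

(* For k = 0, 1 the measures are defined at regular values only; for k = 2
   they are defined for every eps > 0. *)
Definition curv_defined k F eps : Prop :=
  0 < eps /\ ((k < 2)%N -> regular_value F eps).

(* Mass on [Z] of the total variation of the set function [mu]: supremum over
   the finite families of disjoint measurable subsets of [Z]. *)
Definition total_variation d (T : measurableType d) (mu : set T -> \bar R)
    (Z : set T) : \bar R :=
  ereal_sup [set v | exists (n : nat) (B : nat -> set T),
    [/\ forall i, measurable (B i), forall i, B i `<=` Z, trivIset setT B
      & v = (\sum_(i < n) `| mu (B i) |)%E]].

Definition curv_var k F eps : \bar R := total_variation (curv k F eps) setT.

(* beta |-> lebesgue2 (F_eps `&` pi_1 beta) is not additive, so that the
   variation for k = 2 is lebesgue2 F_eps by convention. *)
Definition curv_dir_var k F eps : \bar R :=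
  if (k < 2)%N then total_variation (curv_dir k F eps) (setT `*` unit_circle)
  else lebesgue2 (parallel_set F eps).

End ParallelSets.

Section Exponents.
Context {R : realType}.
Implicit Types (F : set (R * R)) (V : R -> \bar R) (k : nat).

Definition ess_cvg_right0 (f : R -> \bar R) (l : \bar R) : Prop :=
  exists2 N : set R, lebesgue_measure.-negligible N &
    f @ within (~` N) (0 : R)^'+ --> l.

Definition s_exponent k V : \bar R :=
  ereal_inf [set s%:E | s in [set s : R | 0 <= s /\
    ess_cvg_right0 (fun eps => (eps `^ (s - k%:R))%:E * V eps)%E 0%E]].

(* The integral runs over the eps in [D], where [V] is meaningful. *)
Definition a_exponent k (D : set R) V : \bar R :=
  ereal_inf [set s%:E | s in [set s : R | 0 <= s /\
    (fun delta : R => (`|ln delta|^-1)%:E *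
       \int[lebesgue_measure]_(eps in `[delta, 1%R] `&` D)
         ((eps `^ (s - k%:R - 1))%:E * V eps))%E @ (0 : R)^'+ --> 0%E]].

Definition exponents_well_defined k F : Prop :=
  {ae lebesgue_measure, forall eps : R, 0 < eps -> curv_defined k F eps}.

Definition s_curv k F : \bar R := s_exponent k (curv_var k F).
Definition s_curv_dir k F : \bar R := s_exponent k (curv_dir_var k F).

Definition a_curv k F : \bar R :=
  a_exponent k (curv_defined k F) (curv_var k F).
Definition a_curv_dir k F : \bar R :=
  a_exponent k (curv_defined k F) (curv_dir_var k F).

End Exponents.

(* Main.v *)
(* The parallel sets of [F] only depend on the compact set [C], the closure of
   [F]; let [D] be the distance to [C].  Call [y] critical when no direction [u]
   satisfies [<u, y - p> > 0] for all the points [p] of [C] nearest to [y].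

   If [y] is critical then [D z ^ 2 <= D y ^ 2 + |z - y| ^ 2] for every [z], so
   that [D ^ 2] is 2-Hoelder on the critical set.  That set is porous, because
   the points close to the segment from [y] to a nearest point are not critical.
   Hence the set of critical values is Lebesgue null.

   If [eps] is not a critical value, [D] increases at a linear rate along some
   direction around every point of [{D = eps}].  This makes [{D = eps}] locally
   a Lipschitz graph, and together with the semiconcavity of [D ^ 2] it gives
   [{D >= eps}] positive reach; so [eps] is regular.

   For such an [eps] let [y] be a point of [{D = eps}].  If [y] has one nearest
   point [p], its only unit normal is [(p - y) / eps].  If it has several, its
   normals span a proper arc without antipodal points; every principal curvature
   over [y] is then infinite, and the weight of [\tilde C_0] is [1].  In both
   cases the density of [\tilde C_0] has a constant sign over [y], so forgetting
   the normals does not decrease the variation.  (The density of [\tilde C_1] is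
   nonnegative, and for [k = 2] there is nothing to prove.) *)

Require Import Defs.
From HB Require Import structures.
From mathcomp Require Import all_boot all_order all_algebra.
From mathcomp Require Import all_classical all_reals all_analysis.
From mathcomp Require Import measurable_realfun.
From mathcomp Require Import ring lra.
Import Order.TTheory GRing.Theory Num.Theory.
Import numFieldNormedType.Exports.
Local Open Scope classical_set_scope.
Local Open Scope ring_scope.

Set Implicit Arguments.
Unset Strict Implicit.
Unset Printing Implicit Defensive.

(** * Euclidean geometry of the plane *)

Section EuclideanPlane.
Context {R : realType}.
Implicit Types (u v w x y z n p : R * R) (r s t e : R).

Lemma dotpC u v : dotp u v = dotp v u.
Proof. by rewrite /dotp; ring. Qed.

Lemma dotpDl u v w : dotp (u + v) w = dotp u w + dotp v w.
Proof. by rewrite /dotp /=; ring. Qed.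

Lemma dotpNl u w : dotp (- u) w = - dotp u w.
Proof. by rewrite /dotp /=; ring. Qed.

Lemma dotpBl u v w : dotp (u - v) w = dotp u w - dotp v w.
Proof. by rewrite /dotp /=; ring. Qed.

Lemma dotpZl t u w : dotp (t *: u) w = t * dotp u w.
Proof. by rewrite /dotp /= /GRing.scale /=; ring. Qed.

Lemma dotpDr u v w : dotp w (u + v) = dotp w u + dotp w v.
Proof. by rewrite !(dotpC w) dotpDl. Qed.

Lemma dotpNr u w : dotp w (- u) = - dotp w u.
Proof. by rewrite !(dotpC w) dotpNl. Qed.

Lemma dotpBr u v w : dotp w (u - v) = dotp w u - dotp w v.
Proof. by rewrite !(dotpC w) dotpBl. Qed.

Lemma dotpZr t u w : dotp w (t *: u) = t * dotp w u.
Proof. by rewrite !(dotpC w) dotpZl. Qed.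

Definition dotpE := (dotpDl, dotpDr, dotpNl, dotpNr, dotpZl, dotpZr).

Lemma dotpp_ge0 u : 0 <= dotp u u.
Proof. by rewrite /dotp; nra. Qed.

Lemma enorm_ge0 u : 0 <= enorm u.
Proof. exact: sqrtr_ge0. Qed.

Lemma enorm_sqr u : enorm u ^+ 2 = dotp u u.
Proof. by rewrite /enorm sqr_sqrtr// dotpp_ge0. Qed.

Lemma enorm0 : enorm (0 : R * R) = 0.
Proof. by rewrite /enorm /dotp/= !mulr0 addr0 sqrtr0. Qed.

Lemma enorm_eq0 u : enorm u = 0 -> u = 0.
Proof.
move=> h; have := enorm_sqr u; rewrite h /dotp expr0n /=.
case: u {h} => a b /= h.
have a0 : a = 0 by apply/eqP; rewrite -sqrf_eq0; apply/eqP; nra.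
have b0 : b = 0 by apply/eqP; rewrite -sqrf_eq0; apply/eqP; nra.
by rewrite a0 b0.
Qed.

Lemma enorm_gt0 u : u <> 0 -> 0 < enorm u.
Proof.
by move=> u0; rewrite lt_neqAle enorm_ge0 andbT; apply/eqP => /esym/enorm_eq0.
Qed.

Lemma cauchy_schwarz u v : dotp u v <= enorm u * enorm v.
Proof.
have [h|h] := leP (dotp u v) 0.
  by rewrite (le_trans h)// mulr_ge0 ?enorm_ge0.
rewrite -(@ler_pXn2r _ 2) ?nnegrE ?mulr_ge0 ?enorm_ge0//; last exact: ltW.
rewrite exprMn !enorm_sqr /dotp.
have := sqr_ge0 (u.1 * v.2 - u.2 * v.1); nra.
Qed.

Lemma enormN u : enorm (- u) = enorm u.
Proof. by rewrite /enorm dotpNl dotpNr opprK. Qed.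

Lemma enormB u v : enorm (u - v) = enorm (v - u).
Proof. by rewrite -enormN opprB. Qed.

Lemma cauchy_schwarz_abs u v : `|dotp u v| <= enorm u * enorm v.
Proof.
by rewrite ler_norml lerNl -dotpNl -{1}(enormN u) !cauchy_schwarz.
Qed.

Lemma enormD u v : enorm (u + v) <= enorm u + enorm v.
Proof.
rewrite -(@ler_pXn2r _ 2) ?nnegrE ?addr_ge0 ?enorm_ge0//.
rewrite enorm_sqr sqrrD !enorm_sqr !dotpE (dotpC v u).
have := cauchy_schwarz u v; nra.
Qed.

Lemma enormZ t u : enorm (t *: u) = `|t| * enorm u.
Proof. by rewrite /enorm dotpZl dotpZr mulrA -expr2 sqrtrM ?sqr_ge0// sqrtr_sqr. Qed.

Lemma enorm_triangle x y z : enorm (x - z) <= enorm (x - y) + enorm (y - z).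
Proof. by rewrite (_ : x - z = (x - y) + (y - z)) ?enormD// addrA subrK. Qed.

Lemma enormBD u v : enorm (u - v) <= enorm u + enorm v.
Proof. by rewrite -(enormN v) enormD. Qed.

Lemma enorm_fst u : `|u.1| <= enorm u.
Proof. by rewrite -sqrtr_sqr ler_wsqrtr// /dotp; nra. Qed.

Lemma enorm_snd u : `|u.2| <= enorm u.
Proof. by rewrite -sqrtr_sqr ler_wsqrtr// /dotp; nra. Qed.

Lemma enorm_le_sum u : enorm u <= `|u.1| + `|u.2|.
Proof.
have a := normr_ge0 u.1; have b := normr_ge0 u.2.
rewrite -(@ler_pXn2r _ 2) ?nnegrE ?addr_ge0 ?enorm_ge0//.
rewrite enorm_sqr /dotp -!expr2.
rewrite -(real_normK (num_real u.1)) -(real_normK (num_real u.2)).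
nra.
Qed.

Lemma enorm_unit u : enorm u = 1 <-> dotp u u = 1.
Proof.
split=> h; first by rewrite -enorm_sqr h expr1n.
by rewrite /enorm h sqrtr1.
Qed.

(** The topology of the plane comes from the sup norm, which lies between half the Euclidean norm
    and the Euclidean norm. *)
Lemma nbhs_enormP y (A : set (R * R)) :
  nbhs y A <-> exists2 e, 0 < e & forall z, enorm (z - y) < e -> A z.
Proof.
split=> [/nbhs_ballP[e /= e0 yA]|[e e0 yA]].
  exists e => // z zy; apply: yA.
  split; rewrite /ball /=.
    by rewrite distrC (le_lt_trans _ zy)//; exact: (enorm_fst (z - y)).
  by rewrite distrC (le_lt_trans _ zy)//; exact: (enorm_snd (z - y)).
apply/nbhs_ballP; exists (e / 2) => /=; first by rewrite divr_gt0.
move=> z [/= z1 z2]; apply: yA.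
rewrite (le_lt_trans (enorm_le_sum _))// (splitr e) ltrD//.
  by rewrite distrC.
by rewrite distrC.
Qed.

Lemma closure_enormP y (A : set (R * R)) :
  closure A y <-> forall e, 0 < e -> exists2 z, A z & enorm (z - y) < e.
Proof.
split=> [yA e e0|yA B /nbhs_enormP[e e0 yB]].
  have [|z [Az Bz]] := yA [set z | enorm (z - y) < e].
    by apply/nbhs_enormP; exists e.
  by exists z.
by have [z Az /yB Bz] := yA e e0; exists z.
Qed.

Lemma interior_enormP y (A : set (R * R)) :
  interior A y <-> exists2 e, 0 < e & forall z, enorm (z - y) < e -> A z.
Proof. exact: nbhs_enormP. Qed.

Lemma open_enormP (A : set (R * R)) :
  (forall y, A y -> exists2 e, 0 < e & forall z, enorm (z - y) < e -> A z) -> open A.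
Proof. by move=> h; rewrite openE => y /h /interior_enormP. Qed.

Lemma lipschitz_enorm_continuous (f : R * R -> R) (L : R) :
  (forall y z, `|f y - f z| <= L * enorm (y - z)) -> continuous f.
Proof.
move=> lf y; apply/cvgrPdist_lt => e e0.
pose L' := Num.max L 1.
have L0 : 0 < L' by rewrite lt_max ltr01 orbT.
apply/nbhs_enormP; exists (e / L'); first by rewrite divr_gt0.
move=> z; rewrite ltr_pdivlMr// mulrC => zy /=.
rewrite (le_lt_trans (lf _ _))// (le_lt_trans _ zy)// enormB ler_wpM2r ?enorm_ge0//.
by rewrite le_max lexx.
Qed.

Lemma lipschitz_closed (f : R * R -> R) (L : R) r :
  (forall y z, `|f y - f z| <= L * enorm (y - z)) -> closed [set y | r <= f y].
Proof.
move=> /lipschitz_enorm_continuous cf.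
exact: (preimage_closed (fun y _ => cf y) (@closed_ge _ r)).
Qed.

Lemma enorm_closed_bounded_compact (A : set (R * R)) r :
  closed A -> (forall y, A y -> enorm y <= r) -> compact A.
Proof.
move=> cA Ar; apply: (@subclosed_compact _ A (`[- r, r] `*` `[- r, r])) => //.
  by apply: compact_setX; exact: segment_compact.
move=> y /Ar h; split; rewrite /= in_itv /= -ler_norml (le_trans _ h)//.
  exact: enorm_fst.
exact: enorm_snd.
Qed.

Lemma bounded_set_enorm (A : set (R * R)) :
  bounded_set A -> exists r, forall y, A y -> enorm y <= r.
Proof.
move=> [M [_ h]]; exists ((M + 1) + (M + 1)) => y Ay.
have /h /(_ y Ay) /= : M < M + 1 by rewrite ltrDl.
rewrite prod_normE ge_max => /andP[y1 y2].
by rewrite (le_trans (enorm_le_sum _))// lerD.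
Qed.

Lemma compact_min_pos (A : set (R * R)) (f : R * R -> R) : compact A ->
  continuous f -> (forall y, A y -> 0 < f y) ->
  exists2 e, 0 < e & forall y, A y -> e <= f y.
Proof.
move=> cA cf f0; have [[y0 Ay0]|A0] := pselect (A !=set0); last first.
  by exists 1 => // y Ay; exfalso; apply: A0; exists y.
have [|y Ay fm] := @compact_EVT_min _ _ f A (ex_intro _ _ Ay0) cA.
  by apply: continuous_subspaceT.
exists (f y); first by apply: f0; exact: set_mem.
by move=> z Az; apply: fm; exact: mem_set.
Qed.

End EuclideanPlane.

(** * The distance function *)

Lemma maxr_lipschitz (R : realDomainType) (a b a' b' e : R) :
  `|a - a'| <= e -> `|b - b'| <= e -> `|Num.max a b - Num.max a' b'| <= e.
Proof.
rewrite !ler_norml => /andP[h1 h2] /andP[h3 h4].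
by case: (leP a b) => h5; case: (leP a' b') => h6; apply/andP; split; lra.
Qed.

Section Distance.
Context {R : realType}.
Implicit Types (u v w x y z n p q : R * R) (r s t e : R).

(** A real-valued distance, which agrees with [edist_set] for compact nonempty [C] by
    [edist_setE]. *)
Definition dist_to (C : set (R * R)) y : R := inf [set enorm (y - p) | p in C].

Context (C : set (R * R)) (cC : compact C) (C0 : C !=set0).
Local Notation D := (dist_to C).

Lemma dist_to_le y p : C p -> D y <= enorm (y - p).
Proof.
move=> Cp; apply: ge_inf; last by exists p.
by exists 0 => _ [q _ <-]; exact: enorm_ge0.
Qed.

Lemma dist_to_attained y : exists2 p, C p & enorm (y - p) = D y.
Proof.
have [|p Cp pm] := @compact_EVT_min _ _ (fun p => enorm (y - p)) C C0 cC.
  apply: continuous_subspaceT; apply: (@lipschitz_enorm_continuous _ _ 1) => p q.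
  rewrite mul1r ler_norml; have := enorm_triangle y p q.
  have := enorm_triangle y q p; rewrite (enormB q p); lra.
exists p; first exact: set_mem.
apply/eqP; rewrite eq_le dist_to_le ?andbT; last exact: set_mem.
apply: lb_le_inf.
  by case: C0 => q Cq; exists (enorm (y - q)), q.
by move=> _ [q Cq <-]; apply: pm; exact: mem_set.
Qed.

Lemma dist_to_ge0 y : 0 <= D y.
Proof. by have [p _ <-] := dist_to_attained y; exact: enorm_ge0. Qed.

Lemma dist_to_lipschitz y z : D y <= D z + enorm (y - z).
Proof.
have [p Cp <-] := dist_to_attained z.
by rewrite (le_trans (dist_to_le y Cp))// [leRHS]addrC enorm_triangle.
Qed.

Lemma dist_to_lip y z : `|D y - D z| <= 1 * enorm (y - z).
Proof.
rewrite mul1r ler_norml; have := dist_to_lipschitz y z.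
have := dist_to_lipschitz z y; rewrite (enormB z y); lra.
Qed.

Lemma edist_setE y : edist_set y C = (D y)%:E.
Proof.
have [p Cp Dp] := dist_to_attained y.
apply/eqP; rewrite eq_le; apply/andP; split.
  by apply: ereal_inf_lbound; exists p => //; rewrite Dp.
by apply: le_ereal_inf_tmp => _ [q Cq <-]; rewrite lee_fin dist_to_le.
Qed.

Lemma dist_to_far r y : (forall p, C p -> enorm p <= r) -> enorm y <= D y + r.
Proof.
move=> Cr; have [p Cp <-] := dist_to_attained y.
have := Cr p Cp; have := enormD (y - p) p; rewrite subrK; lra.
Qed.

Definition ascent_direction y u :=
  forall p, C p -> enorm (y - p) = D y -> 0 < dotp u (y - p).

Definition critical y := forall u, ~ ascent_direction y u.

(** One constant [rho] bounds the neighbourhood, the step length and the growth rate, so that a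
    compactness argument has a single quantity to make uniform. *)
Definition dist_grows rho u y0 := forall y t, enorm (y - y0) <= rho ->
  0 <= t <= rho -> D y + rho * t <= D (y + t *: u).

(** By compactness there is [c > 0] such that every point of [C] either is at distance at least
    [D y0 + c] from [y0] or satisfies [c <= dotp u (y0 - p)]. Points of the first kind stay far
    enough away under small moves; from the others the distance grows linearly. *)
Lemma ascent_direction_grows y0 u : enorm u = 1 -> ascent_direction y0 u ->
  exists2 rho, 0 < rho & dist_grows rho u y0.
Proof.
move=> u1 yu; pose f p := Num.max (enorm (y0 - p) - D y0) (dotp u (y0 - p)).
have [|p Cp|c c0 fc] := compact_min_pos (f := f) cC.
- apply: (@lipschitz_enorm_continuous _ _ 1) => p q; rewrite mul1r.
  have h1 := enorm_triangle y0 p q; have h2 := enorm_triangle y0 q p.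
  rewrite (enormB q p) in h2.
  have := cauchy_schwarz_abs u (p - q); rewrite u1 mul1r ler_norml.
  have -> : dotp u (p - q) = dotp u (y0 - q) - dotp u (y0 - p).
    by rewrite !dotpE; ring.
  move=> /andP[h3 h4]; rewrite /f.
  apply: maxr_lipschitz; rewrite ler_norml; lra.
- rewrite /f lt_max; have := dist_to_le y0 Cp.
  rewrite le_eqVlt => /orP[/eqP h|h]; first by rewrite yu ?orbT.
  by rewrite subr_gt0 h.
have d0 := dist_to_ge0 y0.
(* For a point [p] of the second kind and [w = y - p], the bound [rho <= k] gives
   [rho * enorm w <= c / 2 <= dotp u w], so the squared new distance is at least
   [(enorm w + rho * t) ^+ 2]. The bound [rho <= c / 4] serves the points of the first kind. *)
pose k := c / (2 * (D y0 + 2 * c)).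
have dc0 : 0 < D y0 + 2 * c by lra.
have k0 : 0 < k by rewrite divr_gt0// mulr_gt0.
have kE : 2 * k * (D y0 + 2 * c) = c by rewrite /k; field; lra.
exists (Num.min 1 (Num.min (c / 4) k)).
  by rewrite !lt_min ltr01 divr_gt0.
set rho := Num.min _ _.
have r1 : rho <= 1 by rewrite ge_min lexx.
have r2 : rho <= c / 4 by rewrite !ge_min lexx orbT.
have r3 : rho <= k by rewrite !ge_min lexx !orbT.
have r0 : 0 < rho by rewrite !lt_min ltr01 divr_gt0.
move=> y t yy0 /andP[t0 tr].
have [p Cp <-] := dist_to_attained (y + t *: u).
have Dy := dist_to_lipschitz y y0.
have [h'|h'] := leP c (enorm (y0 - p) - D y0).
  have h1 := enorm_triangle y0 y p; rewrite (enormB y0 y) in h1.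
  have h2 := enormBD (y + t *: u - p) (t *: u).
  rewrite enormZ u1 mulr1 (ger0_norm t0) addrAC addrK in h2.
  have : rho * t <= t by rewrite ler_piMl.
  lra.
have h : c <= dotp u (y0 - p).
  by have := fc p Cp; rewrite /f le_max leNgt h'.
have E0 := enorm_ge0 (y - p); have E1 := dist_to_le y Cp.
have E2 : enorm (y - p) <= D y0 + 2 * c.
  by have := enorm_triangle y y0 p; lra.
have h1 : c / 2 <= dotp u (y - p).
  have : dotp u (y - p) = dotp u (y0 - p) + dotp u (y - y0).
    by rewrite !dotpE; ring.
  have := cauchy_schwarz_abs u (y - y0); rewrite u1 mul1r ler_norml.
  by move=> /andP[+ _]; lra.
apply: (@le_trans _ _ (enorm (y - p) + rho * t)); first by rewrite lerD2r.
rewrite -(@ler_pXn2r _ 2) ?nnegrE ?enorm_ge0//; last first.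
  by rewrite addr_ge0// mulr_ge0// ltW.
rewrite (_ : y + t *: u - p = (y - p) + t *: u); last by rewrite addrAC.
move: (y - p) E0 E1 E2 h1 => w E0 E1 E2 h1.
have uu : dotp u u = 1 by apply/enorm_unit.
rewrite enorm_sqr !(dotpDl, dotpDr, dotpZl, dotpZr) uu (dotpC w u) -enorm_sqr.
have k1 : rho * (enorm w) <= c / 2.
  have : rho * enorm w <= k * (D y0 + 2 * c) by rewrite ler_pM// ltW.
  lra.
have k2 : t * (rho * enorm w) <= t * (c / 2) by rewrite ler_wpM2l.
have k3 : t * (c / 2) <= t * dotp u w by rewrite ler_wpM2l.
have k4 : (rho * t) ^+ 2 <= t ^+ 2.
  rewrite exprMn ler_piMl ?sqr_ge0// expr_le1// ltW//.
rewrite sqrrD; nra.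
Qed.

End Distance.

(** * The set of critical values is null *)

(** To be read with [v = y - p], [w = q - p] and [(1 - t) *: v + e = z - p], where [p] is nearest to
    [y] and [q] is at least as near to [z] as [p]. The two nearness conditions confine [w] to length
    at most [enorm v / 5], while [z - p] is longer than that, so Cauchy-Schwarz concludes. *)
Lemma porous_vectors (R : realType) (v w e : R * R) (t : R) :
  0 < enorm v -> 0 < t <= 2^-1 -> enorm e <= t * enorm v / 10 ->
  enorm v <= enorm (v - w) ->
  enorm ((1 - t) *: v + e - w) <= enorm ((1 - t) *: v + e) ->
  0 < dotp ((1 - t) *: v + e) ((1 - t) *: v + e - w).
Proof.
move=> r0 /andP[t0 t1] er.
have sq (a b : R * R) : enorm a <= enorm b -> dotp a a <= dotp b b.
  by move=> ab; rewrite -!enorm_sqr ler_pXn2r ?nnegrE ?enorm_ge0.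
move=> /sq + /sq.
move=> k2 k1; rewrite !(dotpBr, dotpBl, dotpC w, dotpDl, dotpZl) in k1 k2.
have h1 : 2 * dotp v w <= enorm w ^+ 2 by rewrite enorm_sqr; lra.
have h2 : enorm w ^+ 2 <= 2 * (1 - t) * dotp v w + 2 * dotp e w.
  by rewrite enorm_sqr; lra.
have h3 := cauchy_schwarz e w.
have w0 := enorm_ge0 w; have e0 := enorm_ge0 e.
have h4 : enorm e * enorm w <= t * enorm v / 10 * enorm w by rewrite ler_wpM2r.
have h5 : (1 - t) * (2 * dotp v w) <= (1 - t) * enorm w ^+ 2.
  by rewrite ler_wpM2l//; lra.
have h6 : t * (enorm w * (enorm w - enorm v / 5)) <= 0 by lra.
have h7 : enorm w <= enorm v / 5.
  rewrite leNgt; apply/negP => h.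
  have : 0 < t * (enorm w * (enorm w - enorm v / 5)).
    by rewrite mulr_gt0// mulr_gt0//; lra.
  lra.
set g := (1 - t) *: v + e in k1 *; rewrite dotpBr -(enorm_sqr g).
have h8 : enorm v - t * enorm v - t * enorm v / 10 <= enorm g.
  have := enormBD g e; rewrite /g addrK enormZ ger0_norm; last by lra.
  by rewrite -/g; lra.
have h9 := cauchy_schwarz g w.
have h10 : t * enorm v <= 2^-1 * enorm v by rewrite ler_wpM2r// ltW.
have : 0 < enorm g * (enorm g - enorm w) by rewrite mulr_gt0//; lra.
lra.
Qed.

Section CriticalPoints.
Context {R : realType} (C : set (R * R)) (cC : compact C) (C0 : C !=set0).
Implicit Types (u v w x y z n p q a : R * R) (r s t e l : R).
Local Notation D := (dist_to C).

Lemma criticalP y u : critical C y ->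
  exists p, [/\ C p, enorm (y - p) = D y & dotp u (y - p) <= 0].
Proof.
move=> /(_ u) /existsNP[p] /not_implyP[Cp] /not_implyP[yp /negP].
by rewrite -leNgt => h; exists p.
Qed.

(** Criticality tested on the direction [z - y] gives a nearest point [p] with
    [dotp (z - y) (y - p) <= 0], which disposes of the cross term in the square of
    [enorm (z - p)]. *)
Lemma critical_dist_sqr y z : critical C y ->
  D z ^+ 2 <= D y ^+ 2 + enorm (z - y) ^+ 2.
Proof.
move=> /(@criticalP _ (z - y))[p [Cp yp h]].
rewrite (@le_trans _ _ (enorm (z - p) ^+ 2))//.
  by rewrite ler_pXn2r ?nnegrE ?enorm_ge0 ?dist_to_ge0// dist_to_le.
rewrite -yp (_ : z - p = (z - y) + (y - p)); last by rewrite addrA subrK.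
move: (z - y) (y - p) h => v w h.
by rewrite !enorm_sqr !(dotpDl, dotpDr) (dotpC w v); lra.
Qed.

(* Every nearest point to [z] is close to [p], so that [z - p] is an ascent
   direction at [z]; hence the critical set is porous. *)
Lemma noncritical_near_segment y p z t : C p -> enorm (y - p) = D y ->
  0 < D y -> 0 < t <= 2^-1 ->
  enorm (z - (y + t *: (p - y))) <= t * D y / 10 -> ~ critical C z.
Proof.
move=> Cp yp r0 t01 he cz.
have zp : z - p = (1 - t) *: (y - p) + (z - (y + t *: (p - y))).
  by apply: injective_projections; rewrite /= /GRing.scale /=; ring.
have [q [Cq zq h]] := criticalP (z - p) cz.
have h1 : enorm (z - q) <= enorm (z - p) by rewrite zq dist_to_le.
have h2 : enorm (y - p) <= enorm (y - q) by rewrite yp dist_to_le.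
have yqE : y - q = (y - p) - (q - p) by rewrite opprB addrA subrK.
have zqE : z - q = (1 - t) *: (y - p) + (z - (y + t *: (p - y))) - (q - p).
  by rewrite -zp opprB addrA subrK.
rewrite zqE zp in h h1; rewrite yqE in h2; rewrite -yp in he r0.
by have := porous_vectors r0 t01 he h2 h1; lra.
Qed.

Definition square a l : set (R * R) :=
  [set z | a.1 <= z.1 <= a.1 + l /\ a.2 <= z.2 <= a.2 + l].

Definition subsquare_corner a l (K : nat) (ij : 'I_K * 'I_K) : R * R :=
  (a.1 + ij.1%:R * (l / K%:R), a.2 + ij.2%:R * (l / K%:R)).

(** The lower bound on [D] turns estimates for the square of [D] into estimates for [D]. *)
Let E s := [set y | critical C y /\ s <= D y].

Lemma grid_index (K : nat) (b w l : R) : (0 < K)%N -> 0 < l ->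
  b <= w <= b + l ->
  exists i : 'I_K, b + i%:R * (l / K%:R) <= w <= b + i%:R * (l / K%:R) + l / K%:R.
Proof.
move=> K0 l0 /andP[bw wl].
have Kr : 0 < K%:R :> R by rewrite ltr0n.
have d0 : 0 < l / K%:R by rewrite divr_gt0.
(* The right end point goes to the last cell, since truncation would give it the index [K]. *)
have [/eqP wE|wl'] := boolP (w == b + l).
  have h : (K.-1 < K)%N by rewrite prednK.
  exists (Ordinal h) => /=.
  have -> : K.-1%:R = K%:R - 1 :> R by rewrite -[in RHS](prednK K0) mulrSr addrK.
  have -> : (K%:R - 1) * (l / K%:R) = l - l / K%:R by field; rewrite gt_eqF.
  by rewrite wE; apply/andP; split; lra.
have {}wl : w < b + l by rewrite lt_neqAle wl'.
pose x := (w - b) / (l / K%:R).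
have x0 : 0 <= x by rewrite divr_ge0 ?subr_ge0// ltW.
have /andP[h1 h2] := truncn_itv x0.
have h : (Num.truncn x < K)%N.
  rewrite -(ltr_nat R) (le_lt_trans h1)// ltr_pdivrMr// mulrC divfK ?gt_eqF//.
  lra.
exists (Ordinal h) => /=.
have wE : w = b + x * (l / K%:R) by rewrite divfK ?gt_eqF// addrC subrK.
have h3 : (Num.truncn x)%:R * (l / K%:R) <= x * (l / K%:R) by rewrite ler_pM2r.
have h4 : x * (l / K%:R) <= (Num.truncn x).+1%:R * (l / K%:R).
  by rewrite ler_pM2r// ltW.
rewrite -natr1 mulrDl mul1r in h4.
by rewrite wE; apply/andP; split; lra.
Qed.

Lemma square_subsquare (K : nat) a l z : (0 < K)%N -> 0 < l ->
  square a l z ->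
  exists ij : 'I_K * 'I_K, square (subsquare_corner a l ij) (l / K%:R) z.
Proof.
move=> K0 l0 [h1 h2].
have [i hi] := grid_index K0 l0 h1; have [j hj] := grid_index K0 l0 h2.
by exists (i, j).
Qed.

Lemma square_diam a l y z : square a l y -> square a l z ->
  [/\ `|z.1 - y.1| <= l, `|z.2 - y.2| <= l & enorm (z - y) <= 2 * l].
Proof.
move=> [/andP[a1 a2] /andP[a3 a4]] [/andP[b1 b2] /andP[b3 b4]].
have h1 : `|z.1 - y.1| <= l by rewrite ler_norml; apply/andP; split; lra.
have h2 : `|z.2 - y.2| <= l by rewrite ler_norml; apply/andP; split; lra.
by split => //; have := enorm_le_sum (z - y); rewrite /=; lra.
Qed.

(** If [E s] avoids the middle of the square, the subsquare containing the centre is free of it.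
    Otherwise one moves from a point of [E s] near the centre towards one of its nearest points; a
    disc around the end point contains no critical point. *)
Lemma subsquare_noncritical (K : nat) s a l : (80 <= K)%N -> 0 < l <= 2 * s ->
  exists ij : 'I_K * 'I_K,
    forall z, square (subsquare_corner a l ij) (l / K%:R) z -> ~ E s z.
Proof.
move=> K80 /andP[l0 ls].
have K0 : (0 < K)%N by rewrite (leq_trans _ K80).
have Kr : 80 <= K%:R :> R by rewrite ler_nat.
have lK : l / K%:R <= l / 80 by rewrite ler_pM2l// lef_pV2 ?posrE ?ltr0n//; lra.
pose mid := (a.1 + l / 2, a.2 + l / 2).
have [[y [[cy sy] [y1 y2]]]|noy] := pselect
    (exists y, E s y /\ `|y.1 - mid.1| <= l / 8 /\ `|y.2 - mid.2| <= l / 8).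
  have [p Cp yp] := dist_to_attained cC C0 y.
  have r0 : 0 < D y by lra.
  (* The move has length [l / 4], which stays inside the square. The noncritical disc has radius
     [t * D y / 10 = l / 40], and [80 <= K] makes the subsquares small enough to fit in it;
     [l <= 2 * s] ensures [t <= 2^-1]. *)
  pose t := l / (4 * D y).
  have tr : t * D y = l / 4 by rewrite /t; field; rewrite gt_eqF.
  have t0 : 0 < t by rewrite divr_gt0// mulr_gt0.
  have t1 : t <= 2^-1.
    by rewrite ler_pdivrMr ?mulr_gt0//; lra.
  pose w := y + t *: (p - y).
  have wy : enorm (w - y) = l / 4.
    by rewrite /w addrC addKr enormZ gtr0_norm// enormB yp.
  have [ij ijw] : exists ij : 'I_K * 'I_K,
      square (subsquare_corner a l ij) (l / K%:R) w.
    apply: square_subsquare => //; clearbody w; have := enorm_fst (w - y).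
    have := enorm_snd (w - y); rewrite wy /= !ler_norml => h1 h2.
    move: y1 y2 h1 h2; rewrite /mid /= !ler_norml.
    by move=> *; split; apply/andP; split; lra.
  exists ij => z zin [cz _].
  have [_ _ zw] := square_diam ijw zin.
  apply: (@noncritical_near_segment y p z t) => //; first by rewrite t0 t1.
  by rewrite -/w tr; lra.
have [ij ijw] : exists ij : 'I_K * 'I_K,
    square (subsquare_corner a l ij) (l / K%:R) mid.
  by apply: square_subsquare => //; split; rewrite /mid /=; apply/andP; split; lra.
exists ij => z zin Ez; apply: noy; exists z; split => //.
by have [h1 h2 _] := square_diam ijw zin; split; lra.
Qed.

(** An upper bound on the outer Lebesgue measure of [A]. *)
Definition covered (A : set R) r := exists G : set R,
  [/\ measurable G, A `<=` G & (lebesgue_measure G <= r%:E)%E].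

Lemma covered_sub (A B : set R) r : A `<=` B -> covered B r -> covered A r.
Proof. by move=> AB [G [mG BG Gr]]; exists G; split=> // x /AB /BG. Qed.

Lemma covered_setU (A B : set R) r s :
  covered A r -> covered B s -> covered (A `|` B) (r + s).
Proof.
move=> [G [mG AG Gr]] [H [mH BH Hs]]; exists (G `|` H); split.
- exact: measurableU.
- exact: setUSS.
- by rewrite EFinD (le_trans (measureU2 _ _ _))// leeD.
Qed.

Lemma covered_bigcup (I : eqType) (A : I -> set R) (c : seq I) r :
  (forall i, i \in c -> covered (A i) r) ->
  covered (\bigcup_(i in [set` c]) A i) ((size c)%:R * r).
Proof.
elim: c => [_|i c ih h].
  exists set0; split => //; first by move=> x [j].
  by rewrite measure0 mul0r.
rewrite (_ : _ * r = r + (size c)%:R * r); last by rewrite /= mulrSr mulrDl mul1r addrC.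
apply: (@covered_sub _ (A i `|` \bigcup_(i in [set` c]) A i)).
  move=> x [j /=]; rewrite in_cons => /orP[/eqP -> ?|jc ?]; first by left.
  by right; exists j.
apply: covered_setU; first by apply: h; rewrite mem_head.
by apply: ih => j jc; apply: h; rewrite in_cons jc orbT.
Qed.

Lemma covered_negligible (A : set R) :
  (forall r, 0 < r -> covered A r) -> lebesgue_measure.-negligible A.
Proof.
move=> h.
have /choice[G hG] : forall n : nat, exists G : set R,
    [/\ measurable G, A `<=` G & (lebesgue_measure G <= (n.+1%:R^-1)%:E)%E].
  by move=> n; apply: h; rewrite invr_gt0 ltr0n.
exists (\bigcap_n G n); split.
- by apply: bigcap_measurable => // n _; have [] := hG n.
- apply/eqP; rewrite eq_le measure_ge0 andbT; apply/lee_addgt0Pr => e e0.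
  rewrite add0e.
  have [n ne] : exists n : nat, n.+1%:R^-1 <= e.
    exists (Num.truncn e^-1); rewrite -[leRHS]invrK lef_pV2 ?posrE ?invr_gt0 ?ltr0n//.
    by rewrite ltW// truncnS_gt.
  have [mG _ Gn] := hG n.
  apply: (@le_trans _ _ (lebesgue_measure (G n))).
    apply: le_measure; rewrite ?inE//.
      by apply: bigcap_measurable => // k _; have [] := hG k.
    exact: bigcap_inf.
  by rewrite (le_trans Gn)// lee_fin.
- by move=> x Ax n _; have [_ + _] := hG n; apply.
Qed.

(** The bound for [j = 0] is proportional to the area of the square. At each step one of the [K * K]
    subsquares misses [E s], and discarding it gains the factor [(K * K).-1%:R / (K * K)%:R]. *)
Lemma critical_values_square (K : nat) s (j : nat) a l : (80 <= K)%N ->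
  0 < l <= 2 * s ->
  covered (D @` (E s `&` square a l))
    (((K * K).-1%:R / (K * K)%:R) ^+ j * (2 / s * l ^+ 2)).
Proof.
move=> K80; elim: j a l => [|j ih] a l /andP[l0 ls].
  have s0 : 0 < s by lra.
  rewrite expr0 mul1r.
  have [[y0 [[cy0 sy0] ay0]]|noE] := pselect (exists y, (E s `&` square a l) y);
      last first.
    exists set0; split => //; first by move=> _ [y Ey <-]; apply: noE; exists y.
    by rewrite measure0 lee_fin mulr_ge0 ?sqr_ge0// divr_ge0// ltW.
  have sl0 : 0 < l ^+ 2 / s by rewrite divr_gt0// exprn_gt0.
  (* Between two points of [E s] in the square the squares of [D] differ by at most [2 * l ^+ 2],
     and [D y + D y0 >= 2 * s]; hence [D y] is within [l ^+ 2 / s] of [D y0]. *)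
  exists `[D y0 - l ^+ 2 / s, D y0 + l ^+ 2 / s]%classic; split => //.
    move=> _ [y [[cy sy] ay] <-] /=; rewrite in_itv /= -ler_distlC.
    have [h1 h2 _] := square_diam ay0 ay.
    have k1 := critical_dist_sqr y cy0; have k2 := critical_dist_sqr y0 cy.
    have yy : enorm (y - y0) ^+ 2 <= 2 * l ^+ 2.
      rewrite enorm_sqr /dotp /= -!expr2.
      rewrite -(real_normK (num_real (y.1 - y0.1))).
      rewrite -(real_normK (num_real (y.2 - y0.2))).
      have : `|y.1 - y0.1| ^+ 2 <= l ^+ 2 by rewrite ler_pXn2r ?nnegrE// ltW.
      have : `|y.2 - y0.2| ^+ 2 <= l ^+ 2 by rewrite ler_pXn2r ?nnegrE// ltW.
      lra.
    rewrite (enormB y0 y) in k2; rewrite distrC ler_pdivlMr//.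
    have h3 : `|D y - D y0| * (D y + D y0) <= 2 * l ^+ 2.
      rewrite -[X in _ * X]ger0_norm; last by lra.
      by rewrite -normrM -subr_sqr ler_norml; apply/andP; split; lra.
    have : `|D y - D y0| * (2 * s) <= `|D y - D y0| * (D y + D y0).
      by rewrite ler_wpM2l//; lra.
    lra.
  rewrite lebesgue_measure_itv /= lte_fin ifT; last by lra.
  by rewrite -EFinB lee_fin; lra.
have ls' : 0 < l <= 2 * s by rewrite l0.
have [ij hij] := subsquare_noncritical a K80 ls'.
have K0 : (0 < K)%N by rewrite (leq_trans _ K80).
have Kr : 0 < K%:R :> R by rewrite ltr0n.
have l'0 : 0 < l / K%:R <= 2 * s.
  rewrite divr_gt0//= (le_trans _ ls)// ler_pdivrMr// ler_peMr ?ler1n//.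
  exact: ltW.
pose c := [seq kk <- enum {: 'I_K * 'I_K} | kk != ij].
have cs : size c = (K * K).-1.
  have := cardC1 ij; rewrite card_prod !card_ord => <-.
  rewrite cardE /c /enum_mem -filter_predI; congr (size _).
  by apply: eq_filter => kk; rewrite !inE andbT.
have h := @covered_bigcup _
  (fun kk => D @` (E s `&` square (subsquare_corner a l kk) (l / K%:R))) c
  (((K * K).-1%:R / (K * K)%:R) ^+ j * (2 / s * (l / K%:R) ^+ 2)).
rewrite cs in h.
rewrite (_ : _ * _ = (K * K).-1%:R * (((K * K).-1%:R / (K * K)%:R) ^+ j *
    (2 / s * (l / K%:R) ^+ 2))); last first.
  rewrite exprS natrM; field; rewrite !gt_eqF//; lra.
apply: covered_sub (h _) => [|kk _]; last exact: ih.
move=> _ [y [Ey ay] <-]; have [kk ykk] := square_subsquare K0 l0 ay.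
exists kk; last by exists y.
rewrite /= mem_filter mem_enum andbT; apply/eqP => kkij.
by apply: hij Ey; rewrite -kkij.
Qed.

Lemma critical_values_square_negligible s a : 0 < s ->
  lebesgue_measure.-negligible (D @` (E s `&` square a s)).
Proof.
move=> s0; apply: covered_negligible => r r0.
pose th : R := (80 * 80).-1%:R / (80 * 80)%:R.
have th0 : 0 <= th by rewrite divr_ge0.
have th1 : th < 1 by rewrite ltr_pdivrMr ?mul1r ?ltr_nat ?ltr0n.
have M0 : 0 < 2 / s * s ^+ 2 by rewrite !mulr_gt0 ?exprn_gt0 ?invr_gt0.
have : th ^+ n @[n --> \oo] --> (0 : R) by apply: cvg_expr; rewrite ger0_norm.
move=> /cvgrPdist_lt /(_ (r / (2 / s * s ^+ 2)) (divr_gt0 r0 M0)).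
move=> [j _ /(_ j (leqnn j))].
rewrite /= sub0r normrN ger0_norm ?exprn_ge0// ltr_pdivlMr// => /ltW h.
have [|G [mG AG Gr]] := @critical_values_square 80 s j a s isT.
  by rewrite s0 ler_peMl ?ler1n// ltW.
by exists G; split => //; rewrite (le_trans Gr)// lee_fin.
Qed.

(** For each side length [n.+1%:R^-1] countably many grid squares cover the plane; a critical value
    [s] is caught by any side length at most [s]. *)
Lemma critical_values_negligible : lebesgue_measure.-negligible
  [set s : R | 0 < s /\ exists2 y, critical C y & D y = s].
Proof.
(* Pairs of integers are enumerated through [pickle]; numbers that encode no pair give the corner at
   the origin. *)
pose corner (s : R) (m : nat) : R * R :=
  let ij := odflt (0, 0) (unpickle m : option (int * int)) in
  (ij.1%:~R * s, ij.2%:~R * s).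
have : lebesgue_measure.-negligible (\bigcup_n \bigcup_m
    (D @` (E n.+1%:R^-1 `&` square (corner n.+1%:R^-1 m) n.+1%:R^-1))).
  apply: negligible_bigcup => n; apply: negligible_bigcup => m.
  by apply: critical_values_square_negligible; rewrite invr_gt0 ltr0n.
apply: negligibleS.
move=> s [s0 [y cy ys]].
have [n ns] : exists n : nat, n.+1%:R^-1 <= s.
  exists (Num.truncn s^-1); rewrite -[leRHS]invrK lef_pV2 ?posrE ?invr_gt0 ?ltr0n//.
  by rewrite ltW// truncnS_gt.
exists n => //; set d : R := n.+1%:R^-1 in ns *.
have d0 : 0 < d by rewrite invr_gt0 ltr0n.
exists (pickle (Num.floor (y.1 / d), Num.floor (y.2 / d))) => //.
exists y => //; split; first by split => //; rewrite ys.
have fl (x : R) : (Num.floor (x / d))%:~R * d <= x <= (Num.floor (x / d))%:~R * d + d.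
  have /andP[h1 h2] := floor_itv (x / d).
  rewrite -ler_pdivlMr// h1 /=.
  rewrite -[X in _ + X]mul1r -mulrDl -ler_pdivrMr// ltW//.
  by move: h2; rewrite intrD.
by rewrite /square /corner pickleK /=; split; exact: fl.
Qed.

End CriticalPoints.

(** * Noncritical values are regular *)

Lemma closed_nearest (R : realType) (X : set (R * R)) (y a : R * R) :
  closed X -> X a ->
  exists2 x, X x & forall z, X z -> enorm (y - x) <= enorm (y - z).
Proof.
(* The part of [X] in the closed disc about [y] through [a]. The signs are reversed because
   [lipschitz_closed] concerns superlevel sets. *)
move=> cX Xa; pose K := X `&` [set z | - enorm (y - a) <= - enorm (y - z)].
have lip : forall p q : R * R, `|enorm (y - p) - enorm (y - q)| <= 1 * enorm (p - q).
  move=> p q; rewrite mul1r ler_norml; have := enorm_triangle y p q.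
  have := enorm_triangle y q p; rewrite (enormB q p); lra.
have cK : compact K.
  apply: (@enorm_closed_bounded_compact _ _ (enorm y + enorm (y - a))).
    apply: closedI => //; apply: (@lipschitz_closed _ _ 1) => p q.
    by rewrite -opprD normrN; exact: lip.
  move=> z [_ /=]; have := enormBD y (y - z); rewrite opprB addrC subrK; lra.
have Ka : K a by split => //=.
have [|x Kx xm] := 
    @compact_EVT_min _ _ (fun z : R * R => enorm (y - z)) K (ex_intro _ a Ka) cK.
  by apply: continuous_subspaceT; exact: (lipschitz_enorm_continuous lip).
have [Xx _] := set_mem Kx.
exists x => // z Xz; have [h|h] := leP (enorm (y - z)) (enorm (y - a)).
  by apply: xm; apply/mem_set; split => //=; rewrite lerN2.
by rewrite (le_trans (xm a (mem_set Ka)))// ltW.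
Qed.

(** Apollonius' formula for the median of a triangle. *)
Lemma midpoint_enorm (R : realType) (x y p : R * R) :
  enorm (2^-1 *: (x + y) - p) ^+ 2 =
  (enorm (x - p) ^+ 2 + enorm (y - p) ^+ 2) / 2 - enorm (x - y) ^+ 2 / 4.
Proof. by rewrite !enorm_sqr /dotp /= /GRing.scale /=; field. Qed.

Section NoncriticalValue.
Context {R : realType} (C : set (R * R)) (cC : compact C) (C0 : C !=set0).
Implicit Types (u v w x y z n p q a : R * R) (r s t e l : R).
Local Notation D := (dist_to C).
Context (eps : R) (eps0 : 0 < eps)
  (noncritical : forall y, D y = eps -> ~ critical C y).

Lemma parallel_setE : parallel_set C eps = [set y | D y <= eps].
Proof. by apply/seteqP; split => y; rewrite /parallel_set /= edist_setE. Qed.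

Lemma noncritical_grows y : D y = eps ->
  exists rho u, [/\ 0 < rho, enorm u = 1 & dist_grows C rho u y].
Proof.
move=> yeps; have /existsNP[u /contrapT yu] := noncritical yeps.
have u0 : 0 < enorm u.
  apply: enorm_gt0 => u0; have [p Cp yp] := dist_to_attained cC C0 y.
  by have := yu p Cp yp; rewrite u0 /dotp /= !mul0r addr0 ltxx.
have [||rho rho0 g] := @ascent_direction_grows _ C cC C0 y ((enorm u)^-1 *: u).
- by rewrite enormZ gtr0_norm ?invr_gt0// mulVf// gt_eqF.
- by move=> p Cp yp; rewrite dotpZl mulr_gt0 ?invr_gt0// yu.
exists rho, ((enorm u)^-1 *: u); split => //.
by rewrite enormZ gtr0_norm ?invr_gt0// mulVf// gt_eqF.
Qed.

Lemma dist_grows_le rho rho' u y z : 0 < rho' <= rho ->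
  enorm (z - y) <= rho - rho' -> dist_grows C rho u y -> dist_grows C rho' u z.
Proof.
move=> /andP[r0 rr] zy g w t wz /andP[t0 tr].
rewrite (@le_trans _ _ (D w + rho * t))//.
  by rewrite lerD2l ler_wpM2r.
apply: g; last by rewrite t0 (le_trans tr).
by have := enorm_triangle w z y; lra.
Qed.

(** It excludes local maxima of [D] at height [eps], which identifies both the closed cocomplement
    and the boundary of the parallel set. *)
Lemma exceed_near y e : D y = eps -> 0 < e ->
  exists2 z, eps < D z & enorm (z - y) < e.
Proof.
move=> yeps e0; have [rho [u [r0 u1 g]]] := noncritical_grows yeps.
pose t := Num.min rho (e / 2).
have t0 : 0 < t by rewrite lt_min r0 divr_gt0.
have te : t < e by rewrite gt_min; apply/orP; right; lra.
exists (y + t *: u); last by rewrite addrC addKr enormZ u1 mulr1 gtr0_norm.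
have := g y t; rewrite subrr enorm0 yeps => /(_ (ltW r0)).
rewrite ltW//= ge_min lexx => /(_ isT).
by have := mulr_gt0 r0 t0; lra.
Qed.

Lemma parallel_cocomplementE : parallel_cocomplement C eps = [set y | eps <= D y].
Proof.
rewrite /parallel_cocomplement parallel_setE; apply/seteqP; split.
  have cX : closed [set y | eps <= D y] := lipschitz_closed (dist_to_lip cC C0).
  rewrite [X in _ `<=` X](closure_id _).1//; apply: closureS => y /=.
  by move=> /negP; rewrite -ltNge => /ltW.
move=> y /=; rewrite le_eqVlt => /orP[/eqP yeps|yeps].
  apply/closure_enormP => e e0; have [z ez zy] := exceed_near (esym yeps) e0.
  by exists z => //=; apply/negP; rewrite -ltNge.
by apply: subset_closure => /=; apply/negP; rewrite -ltNge.
Qed.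

Lemma boundary_cocomplement y :
  boundary (parallel_cocomplement C eps) y -> D y = eps.
Proof.
rewrite parallel_cocomplementE => -[yX yi].
have cX : closed [set y | eps <= D y] := lipschitz_closed (dist_to_lip cC C0).
have XE := (closure_id _).1 cX; move: yX; rewrite -XE => /= ey.
apply/eqP; rewrite eq_le ey andbT leNgt; apply/negP => h; apply: yi.
apply/interior_enormP; exists (D y - eps); first by rewrite subr_gt0.
move=> z zy /=; have := dist_to_lipschitz cC C0 y z; rewrite enormB; lra.
Qed.

Lemma boundary_parallel_set : boundary (parallel_set C eps) = [set y | D y = eps].
Proof.
rewrite parallel_setE; apply/seteqP; split => y.
  move=> [yX yi].
  have yX' : D y <= eps.
    have cX : closed [set z | D z <= eps].
      rewrite (_ : [set z | _] = [set z | - eps <= - D z]); last first.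
        by apply/seteqP; split => z /=; rewrite lerN2.
      apply: (@lipschitz_closed _ _ 1) => p q; rewrite -opprD normrN.
      exact: dist_to_lip.
    by have XE := (closure_id _).1 cX; move: yX; rewrite -XE.
  apply/eqP; rewrite eq_le yX' /= leNgt; apply/negP => h; apply: yi.
  apply/interior_enormP; exists (eps - D y); first by rewrite subr_gt0.
  by move=> z zy /=; have := dist_to_lipschitz cC C0 z y; lra.
move=> /= yeps; split; first by apply: subset_closure; rewrite /= yeps.
move=> /interior_enormP[e e0 h]; have [z ez zy] := exceed_near yeps e0.
by have := h z zy; rewrite /= leNgt ez.
Qed.

(** The level set is compact, and a constant valid at [y] yields every smaller constant than its
    half at the points within its half of [y]. The near-covering form of compactness then gives a
    common constant. *)
Lemma noncritical_grows_uniformly : exists2 rho, 0 < rho &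
  forall y, D y = eps -> exists2 u, enorm u = 1 & dist_grows C rho u y.
Proof.
have [r Cr] : exists r, forall p, C p -> enorm p <= r.
  by apply: bounded_set_enorm; exact: compact_bounded.
have cL : compact [set y | D y = eps].
  apply: (@enorm_closed_bounded_compact _ _ (eps + r)).
    apply: (preimage_closed _ (@closed_eq _ eps)) => y _.
    exact: (lipschitz_enorm_continuous (dist_to_lip cC C0)).
  by move=> y /= <-; exact: dist_to_far.
have /compact_near_coveringP ncL := cL.
have h : \forall rho \near 0^'+, [set y | D y = eps] `<=`
    [set y | exists2 u, enorm u = 1 & dist_grows C rho u y].
  apply: (ncL _ _ (fun rho => [set y | exists2 u, enorm u = 1 & dist_grows C rho u y])).
  move=> y /noncritical_grows[rho [u [r0 u1 g]]].
  exists ([set z | enorm (z - y) < rho / 2], [set t | 0 < t < rho / 2]); first split.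
  - by apply/nbhs_enormP; exists (rho / 2) => //; rewrite divr_gt0.
  - near=> t => /=; apply/andP; split; near: t.
      exact: nbhs_right_gt.
    by apply: nbhs_right_lt; rewrite divr_gt0.
  - move=> [z t] [/= zy /andP[t0 tr]]; exists u => //.
    by apply: dist_grows_le g; lra.
have [rho [/= hr r0]] := filter_ex (filterI h (nbhs_right_gt (0:R))).
by exists rho => // y yeps; have := hr y yeps.
Unshelve. all: by end_near. Qed.

(* If [x] and [y] are both nearest to [z], their midpoint violates [eps <= D] by
   at most [|x - y|^2 / (4 eps)] because [D ^ 2 - |.|^2] is an infimum of affine
   functions, while it is closer to [z] than [x] by [|x - y|^2 / (8 |z - x|)]. *)
Lemma nearest_unique rho r x y z : 0 < rho ->
  (forall y, D y = eps -> exists2 u, enorm u = 1 & dist_grows C rho u y) ->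
  r <= rho -> r <= eps -> r <= eps * rho / 2 ->
  D x = eps -> D y = eps -> enorm (z - x) < r -> enorm (z - y) = enorm (z - x) ->
  (forall w, eps <= D w -> enorm (z - x) <= enorm (z - w)) -> x = y.
Proof.
move=> rho0 ug r1 r2 r3 xeps yeps zx zxy near.
apply: contrapT => xy.
have s0 : 0 < enorm (x - y).
  by apply: enorm_gt0 => /eqP; rewrite subr_eq0 => /eqP.
have [u u1 g] := ug x xeps.
pose m : R * R := 2^-1 *: (x + y).
set s := enorm (x - y) in s0 *; set k := enorm (z - x) in zx zxy near *.
have sk : s <= 2 * k.
  by have := enorm_triangle x z y; rewrite (enormB x z) zxy -/k -/s; lra.
have k0 : 0 < k by lra.
have mx : enorm (m - x) = s / 2.
  rewrite (_ : m - x = 2^-1 *: (y - x)).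
    by rewrite enormZ ger0_norm ?invr_ge0// mulrC enormB.
  by apply: injective_projections; rewrite /m /= /GRing.scale /=; field.
have zm2 : enorm (z - m) ^+ 2 = k ^+ 2 - s ^+ 2 / 4.
  by rewrite enormB midpoint_enorm enormB -/k (enormB y) zxy -/s; field.
have Dm2 : eps ^+ 2 - s ^+ 2 / 4 <= D m ^+ 2.
  have [p Cp <-] := dist_to_attained cC C0 m.
  rewrite midpoint_enorm -/s lerD2r.
  have h1 : eps ^+ 2 <= enorm (x - p) ^+ 2.
    by rewrite ler_pXn2r ?nnegrE ?enorm_ge0 ?(ltW eps0)// -xeps dist_to_le.
  have h2 : eps ^+ 2 <= enorm (y - p) ^+ 2.
    by rewrite ler_pXn2r ?nnegrE ?enorm_ge0 ?(ltW eps0)// -yeps dist_to_le.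
  lra.
have Dm0 := dist_to_ge0 cC C0 m.
have se : s ^+ 2 <= 4 * eps ^+ 2.
  have : s ^+ 2 <= (2 * eps) ^+ 2 by rewrite ler_pXn2r ?nnegrE//; lra.
  by rewrite exprMn; lra.
(* This bounds the amount by which [D m] may fall below [eps]: as [c <= eps], the square of
   [eps - c] is at most [eps ^+ 2 - c * eps = eps ^+ 2 - s ^+ 2 / 4]. *)
pose c := s ^+ 2 / (4 * eps).
have c0 : 0 < c by rewrite divr_gt0 ?exprn_gt0// mulr_gt0.
have cE : c * eps = s ^+ 2 / 4 by rewrite /c; field; rewrite gt_eqF.
have ceps : c <= eps by rewrite ler_pdivrMr ?mulr_gt0//; lra.
have Dm : eps - c <= D m.
  rewrite -(@ler_pXn2r _ 2) ?nnegrE//; last by lra.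
  rewrite (le_trans _ Dm2)// sqrrB.
  have : c * c <= c * eps by rewrite ler_wpM2l// ltW.
  by rewrite -mulr_natl; lra.
(* Moving from the midpoint along [u], where [D] grows at rate [rho], makes up the deficit [c] after
   a step [t]. The bound [r <= eps * rho / 2] makes [t] smaller than [s ^+ 2 / (8 * k)], by which
   the midpoint is closer to [z] than [x] is. *)
pose t := c / rho.
have t0 : 0 < t by rewrite divr_gt0.
have tE : rho * t = c by rewrite /t mulrC divfK// gt_eqF.
have tk : t * (8 * k) < s ^+ 2.
  have -> : t * (8 * k) = s ^+ 2 * (2 * k / (eps * rho)).
    by rewrite /t /c; field; rewrite !gt_eqF.
  rewrite gtr_pMr ?exprn_gt0// ltr_pdivrMr ?mulr_gt0//; lra.
have trho : t <= rho.
  rewrite ler_pdivrMr// ler_pdivrMr ?mulr_gt0//.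
  have h1 : s ^+ 2 <= (2 * rho) * (eps * rho).
    by rewrite expr2 ler_pM//; lra.
  have : 0 < rho * (rho * eps) by rewrite !mulr_gt0.
  lra.
have : eps <= D (m + t *: u).
  have /(_ _) := g m t; rewrite mx => /(_ _); rewrite (ltW t0) trho tE => /(_ _ isT) h.
  have := h _; have : s / 2 <= rho by lra.
  by move=> /[swap] /[apply]; lra.
move=> /near; rewrite leNgt => /negP; apply.
have h1 : enorm (z - (m + t *: u)) <= enorm (z - m) + t.
  by have := enormBD (z - m) (t *: u); rewrite enormZ u1 mulr1 gtr0_norm// opprD addrA.
have h2 : enorm (z - m) <= k - s ^+ 2 / (8 * k).
  have sk2 : s ^+ 2 <= 4 * k ^+ 2.
    have : s ^+ 2 <= (2 * k) ^+ 2 by rewrite ler_pXn2r ?nnegrE//; lra.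
    by rewrite exprMn; lra.
  rewrite -(@ler_pXn2r _ 2) ?nnegrE ?enorm_ge0//; last first.
    by rewrite subr_ge0 ler_pdivrMr ?mulr_gt0//; nra.
  rewrite zm2 sqrrB.
  have -> : k * (s ^+ 2 / (8 * k)) *+ 2 = s ^+ 2 / 4 by field; rewrite gt_eqF.
  by have := sqr_ge0 (s ^+ 2 / (8 * k)); lra.
have h3 : t < s ^+ 2 / (8 * k) by rewrite ltr_pdivlMr ?mulr_gt0.
lra.
Qed.

(** If [eps < D x], then, [D] being 1-Lipschitz, a short move from [x] towards [z] stays in
    [{D >= eps}] and comes closer to [z]. *)
Lemma nearest_on_level x z : D z < eps -> eps <= D x ->
  (forall w, eps <= D w -> enorm (z - x) <= enorm (z - w)) -> D x = eps.
Proof.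
move=> zeps xeps near; apply/eqP; rewrite eq_le xeps andbT leNgt; apply/negP => h.
have k0 : 0 < enorm (z - x).
  by have := dist_to_lipschitz cC C0 x z; rewrite enormB; lra.
pose t := Num.min 1 ((D x - eps) / enorm (z - x)).
have t0 : 0 < t by rewrite lt_min ltr01 divr_gt0// subr_gt0.
have t1 : t <= 1 by rewrite ge_min lexx.
have tk : t * enorm (z - x) <= D x - eps.
  by rewrite -ler_pdivlMr// ge_min lexx orbT.
have := near (x + t *: (z - x)).
rewrite (_ : z - (x + t *: (z - x)) = (1 - t) *: (z - x)); last first.
  by rewrite scalerBl scale1r opprD addrA.
rewrite enormZ ger0_norm ?subr_ge0// => /(_ _).
have := dist_to_lipschitz cC C0 x (x + t *: (z - x)).
rewrite opprD addrA subrr sub0r enormN enormZ gtr0_norm//.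
move=> h1 /(_ _) h2.
have : enorm (z - x) <= (1 - t) * enorm (z - x) by apply: h2; lra.
by have := mulr_gt0 t0 k0; lra.
Qed.

Lemma noncritical_positive_reach : positive_reach (parallel_cocomplement C eps).
Proof.
have cX : closed [set y | eps <= D y] := lipschitz_closed (dist_to_lip cC C0).
rewrite parallel_cocomplementE; split => //.
have [rho rho0 ug] := noncritical_grows_uniformly.
(* These are the bounds that [nearest_unique] asks for; as [rho] is uniform, the same radius serves
   at every point [a]. *)
pose r := Num.min rho (Num.min eps (eps * rho / 2)).
have r0 : 0 < r by rewrite !lt_min rho0 eps0 !mulr_gt0.
have r1 : r <= rho by rewrite ge_min lexx.
have r2 : r <= eps by rewrite !ge_min lexx orbT.
have r3 : r <= eps * rho / 2 by rewrite !ge_min lexx !orbT.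
apply: (@lt_le_trans _ _ r%:E); first by rewrite lte_fin.
apply: le_ereal_inf_tmp => _ [a aX <-].
apply: ereal_sup_ubound; exists r => //; split; first exact: ltW.
move=> z za; rewrite /unique_nearest /=.
have [zeps|zeps] := ltP (D z) eps; last first.
  exists z; split; first by split => // w _; rewrite subrr enorm0 enorm_ge0.
  move=> x [_ /(_ z zeps)]; rewrite subrr enorm0 => h.
  have /enorm_eq0/eqP : enorm (z - x) = 0.
    by apply/eqP; rewrite eq_le h enorm_ge0.
  by rewrite subr_eq0 => /eqP.
have [x xX xm] := closed_nearest z cX aX.
exists x; split => // y [yX ym].
have zx : enorm (z - x) < r.
  by rewrite (le_lt_trans (xm a aX)).
have xeps := nearest_on_level zeps xX xm.
have yeps := nearest_on_level zeps yX ym.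
apply: (nearest_unique rho0 ug r1 r2 r3 xeps yeps zx) => //.
by apply/eqP; rewrite eq_le ym// xm.
Qed.

(** In the coordinates [s] along [v] and [t] along [u], [D] is 1-Lipschitz in [s] and increases at
    rate at least [c] in [t]. The level set is therefore locally the graph of a function [tau] with
    Lipschitz constant [c^-1]. *)
Lemma noncritical_lipschitz_manifold :
  lipschitz_manifold1 (boundary (parallel_set C eps)).
Proof.
rewrite boundary_parallel_set => p /= peps.
have [rho [u [rho0 u1 g']]] := noncritical_grows peps.
pose c := Num.min rho 1.
have c0 : 0 < c by rewrite lt_min rho0 ltr01.
have c1 : c <= 1 by rewrite ge_min lexx orbT.
have {g'} g : dist_grows C c u p.
  apply: (@dist_grows_le rho _ _ p) g'; first by rewrite c0 ge_min lexx.
  by rewrite subrr enorm0 subr_ge0 ge_min lexx.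
have uu : dotp u u = 1 by apply/enorm_unit.
pose v : R * R := (- u.2, u.1).
have uv : dotp u v = 0 by rewrite /dotp /v /=; ring.
have vu : dotp v u = 0 by rewrite dotpC.
have vv : dotp v v = 1 by rewrite -uu /dotp /v /=; ring.
have v1 : enorm v = 1 by apply/enorm_unit.
(* Since [a + b] and [2 * b] are at most [c], the growth property [g] applies in the whole box. On
   [t = 0] the values of [D] are within [a] of [eps], and over a length [b] the function grows by at
   least [c * b = 2 * a], so it crosses [eps] inside the box. *)
pose b := c / 4; pose a := c * b / 2.
have b0 : 0 < b by rewrite divr_gt0.
have a0 : 0 < a by rewrite divr_gt0// mulr_gt0.
have cb : c * b <= b by rewrite ler_piMl// ltW.
have bE : b = c / 4 by [].
have aE : a = c * b / 2 by [].
clearbody a b.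
pose pt s t := p + s *: v + t *: u.
have pt_add s t t' : pt s t + t' *: u = pt s (t + t').
  by rewrite /pt scalerDl addrA.
have ptB s t s' t' : enorm (pt s t - pt s' t') ^+ 2 = (s - s') ^+ 2 + (t - t') ^+ 2.
  rewrite (_ : _ - _ = (s - s') *: v + (t - t') *: u); last first.
    by apply: injective_projections; rewrite /pt /= /GRing.scale /=; ring.
  rewrite enorm_sqr !(dotpDl, dotpDr, dotpZl, dotpZr) uu vv uv vu; ring.
have ptp s t : enorm (pt s t - p) <= `|s| + `|t|.
  rewrite (_ : pt s t - p = s *: v + t *: u); last first.
    by rewrite /pt -(addrA p) [p + _]addrC addrK.
  by rewrite (le_trans (enormD _ _))// !enormZ u1 v1 !mulr1.
have grow s t t' : `|s| <= a -> `|t| <= b -> t <= t' <= b ->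
    D (pt s t) + c * (t' - t) <= D (pt s t').
  move=> sa tb /andP[tt' t'b].
  have -> : pt s t' = pt s t + (t' - t) *: u by rewrite pt_add addrCA subrr addr0.
  apply: g; first by rewrite (le_trans (ptp _ _))//; lra.
  move: tb; rewrite ler_norml => /andP[h1 h2].
  by apply/andP; split; lra.
have D0 s : `|D (pt s 0) - eps| <= `|s|.
  rewrite -peps (le_trans (dist_to_lip cC C0 _ _))// mul1r.
  by rewrite (le_trans (ptp _ _))// normr0 addr0.
(* The value 0 for [a <= |s|] is a dummy that makes [tau] total. *)
have tauP s : exists t, `|s| < a -> `|t| < b /\ D (pt s t) = eps.
  have [sa|_] := ltP `|s| a; last by exists 0.
  have h0 := D0 s; rewrite ler_norml in h0.
  have hb : D (pt s (- b)) < eps.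
    have := @grow s (- b) 0; rewrite normrN (gtr0_norm b0) (ltW sa) lexx.
    rewrite ltW ?oppr_lt0// (ltW b0) => /(_ isT isT isT).
    by lra.
  have hb' : eps < D (pt s b).
    have := @grow s 0 b; rewrite normr0 (ltW sa) (ltW b0) lexx => /(_ isT isT isT).
    by lra.
  have [|||t tb teps] := @IVT R (fun t => D (pt s t)) (- b) b eps.
  - by lra.
  - apply: continuous_subspaceT => t.
    have lip (t1 t2 : R) : `|D (pt s t1) - D (pt s t2)| <= `|t1 - t2|.
      rewrite (le_trans (dist_to_lip cC C0 _ _))// mul1r.
      have -> : pt s t1 - pt s t2 = (t1 - t2) *: u.
        by apply: injective_projections; rewrite /pt /= /GRing.scale /=; ring.
      by rewrite enormZ u1 mulr1.
    apply/cvgrPdist_lt => e e0; apply/nbhs_ballP; exists e => //= t'.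
    by rewrite /ball /= => tt; rewrite (le_lt_trans (lip _ _)).
  - by rewrite ge_min le_max (ltW hb) (ltW hb') orbT.
  exists t => _; split => //; move: tb; rewrite in_itv /= ltr_norml => /andP[t1 t2].
  rewrite !lt_neqAle t1 t2 !andbT; apply/andP; split; apply/eqP => h.
    by move: teps hb; rewrite -h => ->; rewrite ltxx.
  by move: teps hb'; rewrite h => ->; rewrite ltxx.
have /choice[tau tauE] := tauP.
pose I := [set s : R | - a < s < a].
have Ia s : I s -> `|s| < a by rewrite ltr_norml.
have mono s t t' : `|s| < a -> `|t| < b -> `|t'| < b -> t < t' ->
    D (pt s t) < D (pt s t').
  move=> sa tb t'b tt'.
  have := @grow s t t' (ltW sa) (ltW tb).
  rewrite (ltW tt') /= (le_trans (ler_norm _) (ltW t'b)) => /(_ isT).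
  by have := mulr_gt0 c0 (_ : 0 < t' - t); rewrite subr_gt0 => /(_ tt'); lra.
exists [set y | `|dotp v (y - p)| < a /\ `|dotp u (y - p)| < b], I,
  (fun s => pt s (tau s)), (1 + c^-1).
split.
- apply: open_enormP => y [h1 h2].
  exists (Num.min (a - `|dotp v (y - p)|) (b - `|dotp u (y - p)|)).
    by rewrite lt_min !subr_gt0 h1.
  move=> z; rewrite lt_min => /andP[k1 k2].
  have zE w : dotp w (z - p) = dotp w (z - y) + dotp w (y - p).
    by rewrite -dotpDr addrA subrK.
  have cv := cauchy_schwarz_abs v (z - y); have cu := cauchy_schwarz_abs u (z - y).
  rewrite v1 u1 !mul1r in cv cu.
  by split; rewrite zE (le_lt_trans (ler_normD _ _))//; lra.
- by rewrite /= subrr /dotp /= !mulr0 addr0 normr0.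
- rewrite (_ : I = `]- a, a[%classic); first exact: interval_open.
  by apply/seteqP; split => s; rewrite /= in_itv.
- apply/seteqP; split => [_ [s /Ia sa <-]|y [/= yeps [ya yb]]].
    have [tb teps] := tauE s sa; split => //=.
    have -> : pt s (tau s) - p = s *: v + tau s *: u.
      by rewrite /pt -(addrA p) [p + _]addrC addrK.
    by rewrite !dotpDr !dotpZr uu vv uv vu !mulr1 !mulr0 addr0 add0r.
  set s := dotp v (y - p) in ya; set t := dotp u (y - p) in yb.
  have yE : y = pt s t.
    have h : u.1 * u.1 + u.2 * u.2 = 1 by [].
    apply: injective_projections; rewrite /pt /s /t /v /dotp /= /GRing.scale /=.
      transitivity (p.1 + (u.1 * u.1 + u.2 * u.2) * (y.1 - p.1)); last by ring.
      by rewrite h mul1r addrC subrK.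
    transitivity (p.2 + (u.1 * u.1 + u.2 * u.2) * (y.2 - p.2)); last by ring.
    by rewrite h mul1r addrC subrK.
  have [tb teps] := tauE s ya.
  exists s; first by rewrite /I /= -ltr_norml.
  rewrite [RHS]yE; congr (pt s _).
  move: yeps; rewrite yE -teps => h.
  apply/eqP; rewrite eq_le !leNgt; apply/andP; split; apply/negP => hlt.
    by have := mono s t (tau s) ya yb tb hlt; rewrite h ltxx.
  by have := mono s (tau s) t ya tb yb hlt; rewrite h ltxx.
- have ci0 : 0 < c^-1 by rewrite invr_gt0.
  split; first lra.
  have tau_lip s s' : I s -> I s' -> tau s - tau s' <= c^-1 * `|s - s'|.
    move=> /Ia sa /Ia s'a; have [tb teps] := tauE s sa; have [tb' teps'] := tauE s' s'a.
    have [tt|tt] := leP (tau s) (tau s').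
      by rewrite (@le_trans _ _ 0) ?subr_le0// mulr_ge0// ltW.
    have := @grow s' (tau s') (tau s) (ltW s'a) (ltW tb').
    rewrite (ltW tt) /= (le_trans (ler_norm _) (ltW tb)) teps' => /(_ isT).
    have := dist_to_lip cC C0 (pt s' (tau s)) (pt s (tau s)).
    rewrite teps mul1r.
    have -> : enorm (pt s' (tau s) - pt s (tau s)) = `|s - s'|.
      apply/eqP; rewrite -(@eqrXn2 _ 2) ?enorm_ge0// ptB subrr expr0n addr0.
      by rewrite real_normK ?num_real// -sqrrN opprB.
    rewrite ler_norml => /andP[_ h1] h2.
    by rewrite mulrC ler_pdivlMr// mulrC; lra.
  move=> s s' sI s'I.
  have h := ptB s (tau s) s' (tau s').
  have n0 := enorm_ge0 (pt s (tau s) - pt s' (tau s')).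
  have lower : `|s - s'| <= enorm (pt s (tau s) - pt s' (tau s')).
    rewrite -(@ler_pXn2r _ 2) ?nnegrE// h real_normK ?num_real//.
    by have := sqr_ge0 (tau s - tau s'); lra.
  apply/andP; split.
    rewrite (le_trans _ lower)// ler_piMl// invf_le1; lra.
  have t1 := tau_lip s s' sI s'I; have t2 := tau_lip s' s s'I sI.
  rewrite distrC in t2.
  have tl : `|tau s - tau s'| <= c^-1 * `|s - s'|.
    by rewrite ler_norml; apply/andP; split; lra.
  rewrite mulrDl mul1r (@le_trans _ _ (`|s - s'| + `|tau s - tau s'|))//; last first.
    by rewrite lerD2l.
  rewrite -(@ler_pXn2r _ 2) ?nnegrE ?addr_ge0// h [leRHS]sqrrD !real_normK ?num_real//.
  have := mulr_ge0 (normr_ge0 (s - s')) (normr_ge0 (tau s - tau s')).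
  lra.
Qed.

Lemma noncritical_regular_value : regular_value C eps.
Proof.
split=> //; first exact: noncritical_positive_reach.
exact: noncritical_lipschitz_manifold.
Qed.

End NoncriticalValue.

(** * Normals and principal curvatures at a noncritical level *)

Section NormalFibers.
Context {R : realType}.
Implicit Types (X : set (R * R)) (u v w x y z n p q a b : R * R) (r s t e : R).

Lemma tangent_cone_segment X y w t0 : 0 < t0 ->
  (forall t, 0 < t < t0 -> X (y + t *: w)) -> tangent_cone enorm X y w.
Proof.
move=> t00 h; have [->|w0] := pselect (w = 0); first by left.
right => e e0; have wn := enorm_gt0 w0.
pose t := Num.min (t0 / 2) (e / (2 * enorm w)).
have t1 : 0 < t by rewrite lt_min !divr_gt0// mulr_gt0.
have t2 : t <= t0 / 2 by rewrite ge_min lexx.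
have te : t * enorm w <= e / 2.
  rewrite -ler_pdivlMr// (_ : _ / _ / _ = e / (2 * enorm w)); last first.
    by field; rewrite gt_eqF.
  by rewrite ge_min lexx orbT.
exists (y + t *: w); rewrite [y + _]addrC addrK enormZ gtr0_norm//; split.
- by rewrite addrC; apply: h; rewrite t1; lra.
- by rewrite mulr_gt0//; lra.
- rewrite scalerA invfM mulrAC mulVf ?gt_eqF// mul1r subrr enorm0//.
Qed.

Lemma normal_coneD X y (s t : R) n n' : 0 <= s -> 0 <= t ->
  normal_cone X y n -> normal_cone X y n' -> normal_cone X y (s *: n + t *: n').
Proof.
move=> s0 t0 h h' u /[dup] /h hu /h' hu'.
rewrite dotpDr !dotpZr; have := mulr_ge0_le0 s0 hu; have := mulr_ge0_le0 t0 hu'.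
lra.
Qed.

(** The normal cone is convex, hence contains the directions between [n] and [m]. Turning [n]
    towards [m] with [y] fixed stays in [nor X] and has the tangent direction [(0, b)]. *)
Lemma arc_tangent X y n m b : boundary X y -> enorm n = 1 ->
  normal_cone X y n -> normal_cone X y m ->
  enorm b = 1 -> dotp n b = 0 -> 0 < dotp m b -> m = dotp m n *: n + dotp m b *: b ->
  tangent_cone enorm4 (nor X) (y, n) (0, b).
Proof.
move=> yX n1 nX mX b1 nb mb mE; right => e e0.
have nn : dotp n n = 1 by apply/enorm_unit.
have bb : dotp b b = 1 by apply/enorm_unit.
have bn : dotp b n = 0 by rewrite dotpC.
set al := dotp m n in mE; set be := dotp m b in mb mE.
(* The turned normal is at distance [2 * s] from [n], which the second bound makes smaller than [e].
   With the first bound, the third one keeps the coefficient of [n] nonnegative when the turned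
   normal is written in terms of [n] and [m]. *)
pose s := Num.min 4^-1 (Num.min (e / 4) (be / (4 * (`|al| + 1)))).
have al0 : 0 < `|al| + 1 by rewrite ltr_wpDl.
have s0 : 0 < s by rewrite !lt_min invr_gt0 ltr0n (divr_gt0 e0)//= divr_gt0// mulr_gt0.
have s1 : s <= 4^-1 by rewrite ge_min lexx.
have s2 : s <= e / 4 by rewrite !ge_min lexx orbT.
have s3 : s * (4 * (`|al| + 1)) <= be.
  by rewrite -ler_pdivlMr ?mulr_gt0// !ge_min lexx !orbT.
clearbody s.
have ss : s * s <= 4^-1 * s by rewrite ler_wpM2r// ltW.
pose c := Num.sqrt (1 - s ^+ 2).
have c2 : c ^+ 2 = 1 - s ^+ 2 by rewrite sqr_sqrtr// expr2; lra.
have c0 : 0 <= c by rewrite sqrtr_ge0.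
have c1 : c <= 1.
  by rewrite -(@ler_pXn2r _ 2) ?nnegrE// c2 expr1n gerBl sqr_ge0.
clearbody c.
(* [n'] is [n] turned towards [m] by twice the angle of sine [s] and cosine [c]. *)
pose n' := (c ^+ 2 - s ^+ 2) *: n + (2 * s * c) *: b.
have n'n : n' - n = (- (2 * s ^+ 2)) *: n + (2 * s * c) *: b.
  by rewrite /n' c2; apply: injective_projections; rewrite /= /GRing.scale /=; ring.
have n'1 : enorm n' = 1.
  apply/enorm_unit; rewrite /n' !(dotpDl, dotpDr, dotpZl, dotpZr) nn bb nb bn.
  transitivity ((c ^+ 2 + s ^+ 2) ^+ 2); first by ring.
  by rewrite c2 subrK expr1n.
have n'X : normal_cone X y n'.
  have -> : n' = (c ^+ 2 - s ^+ 2 - 2 * s * c * al / be) *: n + (2 * s * c / be) *: m.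
    rewrite /n' [in RHS]mE.
    by apply: injective_projections; rewrite /= /GRing.scale /=; field; rewrite gt_eqF.
  apply: normal_coneD => //; last by rewrite divr_ge0 ?mulr_ge0// ltW.
  rewrite subr_ge0 ler_pdivrMr// c2.
  have sal : 2 * s * c * al <= 2 * s * `|al|.
    rewrite -!mulrA ler_wpM2l// ler_wpM2l//; first exact: ltW.
    by rewrite (le_trans (ler_norm _))// normrM (ger0_norm c0) ler_piMl.
  have : s * `|al| <= be / 4 by lra.
  have : 2^-1 * be <= (1 - s ^+ 2 - s ^+ 2) * be.
    by rewrite ler_wpM2r//; [exact: ltW|rewrite expr2; lra].
  lra.
have dn : enorm (n' - n) = 2 * s.
  apply/eqP; rewrite -(@eqrXn2 _ 2) ?enorm_ge0//; last by lra.
  rewrite enorm_sqr n'n !(dotpDl, dotpDr, dotpZl, dotpZr) nn bb nb bn.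
  apply/eqP; transitivity (4 * s ^+ 2 * (s ^+ 2 + c ^+ 2)); first by ring.
  by rewrite c2; ring.
have enorm4_snd z : enorm4 (0, z) = enorm z.
  by rewrite /enorm4 /enorm /= {1}/dotp /= !mulr0 !add0r.
exists (y, n'); have -> : (y, n') - (y, n) = (0, n' - n).
  by apply: injective_projections => //=; rewrite subrr.
rewrite !enorm4_snd dn b1; split.
- by split.
- by apply/andP; split; lra.
rewrite (_ : _ - _ = (0, (- s) *: n + (c - 1) *: b)); last first.
  rewrite n'n; apply: injective_projections => /=; first by rewrite !scaler0 subrr.
  apply: injective_projections; rewrite /= /GRing.scale /=; field;
  by rewrite gt_eqF.
rewrite enorm4_snd (@le_lt_trans _ _ (2 * s))//; last by lra.
rewrite -(@ler_pXn2r _ 2) ?nnegrE ?enorm_ge0//; last by lra.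
rewrite enorm_sqr !(dotpDl, dotpDr, dotpZl, dotpZr) nn bb nb bn.
have : (1 - c) * c >= 0 by rewrite mulr_ge0// subr_ge0.
rewrite exprMn; nra.
Qed.

(** The tangent cone of [nor X] contains a vector [(0, b)] with [b <> 0], whereas the line spanned
    by [curvature_vector] for a finite curvature contains no such vector. *)
Lemma arc_principal_curvature X y n m : nor X (y, n) -> nor X (y, m) ->
  n <> m -> n <> - m -> principal_curvature X (y, n) = +oo%E.
Proof.
move=> [yX /= n1 nX] [_ /= m1 mX] nm nm'.
have nn : dotp n n = 1 by apply/enorm_unit.
have mm : dotp m m = 1 by apply/enorm_unit.
pose b0 : R * R := (- n.2, n.1).
have decomp (k : R) : k * k = 1 ->
    m = dotp m n *: n + dotp m (k *: b0) *: (k *: b0).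
  move=> kk; have h : n.1 * n.1 + n.2 * n.2 = 1 by [].
  apply: injective_projections; rewrite /b0 /dotp /= /GRing.scale /=.
    transitivity (m.1 * (n.1 * n.1 + (k * k) * (n.2 * n.2)) +
      m.2 * n.2 * n.1 * (1 - k * k)); last by ring.
    by rewrite kk mul1r h subrr; ring.
  transitivity (m.2 * (n.2 * n.2 + (k * k) * (n.1 * n.1)) +
    m.1 * n.1 * n.2 * (1 - k * k)); last by ring.
  by rewrite kk mul1r addrC (addrC (n.2 * _)) h subrr; ring.
have b0n : dotp m b0 <> 0.
  move=> h0; have := decomp 1 (mulr1 1); rewrite scale1r h0 scale0r addr0 => mE.
  have : dotp m n ^+ 2 = 1.
    by rewrite -mm [in RHS]mE dotpZl dotpZr nn; ring.
  move/eqP; rewrite sqrf_eq1 => /orP[/eqP h|/eqP h]; rewrite h in mE.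
    by apply: nm; rewrite mE scale1r.
  by apply: nm'; rewrite mE scaleN1r opprK.
have [b [b1 nb tb]] : exists b, [/\ enorm b = 1, b <> 0 &
    tangent_cone enorm4 (nor X) (y, n) (0, b)].
  have [k kk kb] : exists2 k : R, k * k = 1 & 0 < dotp m (k *: b0).
    have [h|h] := ltP 0 (dotp m b0); first by exists 1; rewrite ?mulr1// scale1r.
    exists (-1); first by rewrite mulrNN mulr1.
    rewrite scaleN1r dotpNr oppr_gt0 lt_neqAle h andbT; exact/eqP.
  have kb1 : enorm (k *: b0) = 1.
    apply/enorm_unit; rewrite dotpZl dotpZr mulrA kk mul1r -nn /dotp /b0 /=; ring.
  exists (k *: b0); split => //.
    by move=> h; move: kb1; rewrite h enorm0 => /esym/eqP; rewrite oner_eq0.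
  apply: (arc_tangent (m := m)) => //; last exact: decomp.
  rewrite dotpZr /dotp /b0 /=; ring.
(* If no principal curvature exists, the value is the default [+oo]. *)
rewrite /principal_curvature; case: xgetP => [kappa _ [ninf [a [a1 _ tE]]]|//].
case: kappa ninf tE => [r _ tE|//|//].
move: tb; rewrite tE => -[t _]; rewrite /curvature_vector => /pair_equal_spec[/= h1 h2].
have c0 : 0 < Num.sqrt (1 + r ^+ 2) by rewrite sqrtr_gt0 ltr_wpDr// sqr_ge0.
have t0 : t = 0.
  have h1' : t *: ((Num.sqrt (1 + r ^+ 2))^-1 *: a) = 0 by exact: h1.
  have := congr1 enorm h1'; rewrite scalerA enormZ a1 mulr1 enorm0 => /eqP.
  by rewrite normr_eq0 mulf_eq0 invr_eq0 (gt_eqF c0) orbF => /eqP.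
by exfalso; apply: nb; rewrite -h2 t0 scale0r.
Qed.

End NormalFibers.

(** * Borel sets of the plane *)

Section BorelPlane.
Context {R : realType}.
Implicit Types (A U : set (R * R)) (y p : R * R).

(** The sigma-algebra of the plane is the product one, so an open set is written as a countable
    union of boxes with rational centres. *)
Lemma open_measurable_plane U : open U -> measurable U.
Proof.
move=> oU; pose box (a b : rat) (n : nat) : set (R * R) :=
  ball (ratr a : R) n.+1%:R^-1 `*` ball (ratr b : R) n.+1%:R^-1.
pose F (a b : rat) (n : nat) := [set y | box a b n y /\ box a b n `<=` U].
have -> : U = \bigcup_a \bigcup_b \bigcup_n F a b n.
  apply/seteqP; split => [y Uy|y [a _ [b _ [n _ [yb]]]]]; last exact.
  move: oU; rewrite openE => /(_ _ Uy) /interior_enormP[e e0 eU].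
  have [n ne] : exists n : nat, n.+1%:R^-1 < e / 4.
    exists (Num.truncn (e / 4)^-1); rewrite -[ltRHS]invrK.
    rewrite ltf_pV2 ?posrE ?invr_gt0 ?ltr0n ?divr_gt0//.
    by rewrite truncnS_gt.
  have d0 : 0 < n.+1%:R^-1 :> R by rewrite invr_gt0 ltr0n.
  have rat_near (x : R) : exists a : rat, `|ratr a - x| < n.+1%:R^-1.
    have xx : x - n.+1%:R^-1 < x + n.+1%:R^-1 by rewrite ltrD2l gtrN.
    have [a] := rat_in_itvoo xx; rewrite in_itv /= => ax.
    by exists a; rewrite distrC ltr_distlC.
  have [a ay] := rat_near y.1; have [b yb] := rat_near y.2.
  exists a => //; exists b => //; exists n => //; split; first by split.
  move=> z [za zb]; apply: eU; rewrite (le_lt_trans (enorm_le_sum _))//=.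
  rewrite /box /ball /= in za zb.
  have := ler_distD (ratr a) z.1 y.1; have := ler_distD (ratr b) z.2 y.2.
  rewrite (distrC z.1 (ratr a)) (distrC z.2 (ratr b)).
  by move: (n.+1%:R^-1) ne za zb ay yb => d *; lra.
apply: bigcupT_measurable_rat => a; apply: bigcupT_measurable_rat => b.
apply: bigcupT_measurable => n.
have [h|h] := pselect (box a b n `<=` U).
  rewrite (_ : F a b n = box a b n); last first.
    by apply/seteqP; split => y; [case|split].
  by apply: measurableX; apply: open_measurable; apply: ball_open;
    rewrite invr_gt0 ltr0n.
rewrite (_ : F a b n = set0)//.
by apply/seteqP; split => // y [].
Qed.

Lemma closed_measurable_plane A : closed A -> measurable A.
Proof.
move=> cA; rewrite -(setCK A); apply: measurableC.
by apply: open_measurable_plane; rewrite openC.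
Qed.

Lemma unit_circle_measurable : measurable (@unit_circle R).
Proof.
apply: closed_measurable_plane; apply: (preimage_closed _ (@closed_eq _ 1)) => y _.
apply: (@lipschitz_enorm_continuous _ _ 1) => {}y z.
rewrite mul1r ler_norml; have := enormD (y - z) z; have := enormD (z - y) y.
rewrite !subrK (enormB z y); lra.
Qed.

(** Applied to closed pieces of [C], this gives the measurability of conditions on the nearest
    points. *)
Lemma compact_near_closed A (e : R) : compact A ->
  closed [set y | exists2 p, A p & enorm (y - p) <= e].
Proof.
move=> cA; have [A0|A0] := pselect (A !=set0); last first.
  rewrite (_ : [set y | _] = set0); first exact: closed0.
  by apply/seteqP; split => // y [p Ap _]; apply: A0; exists p.
rewrite (_ : [set y | _] = [set y | - e <= - dist_to A y]).
  apply: (@lipschitz_closed _ _ 1) => p q; rewrite -opprD normrN.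
  exact: dist_to_lip.
apply/seteqP; split => y /=; rewrite lerN2.
  by move=> [p Ap yp]; rewrite (le_trans (dist_to_le y Ap)).
by move=> h; have [p Ap yp] := dist_to_attained cA A0 y; exists p; rewrite ?yp.
Qed.

End BorelPlane.

(** * Normals over points with one and with several nearest points *)

Section NoncriticalNormals.
Context {R : realType} (C : set (R * R)) (cC : compact C) (C0 : C !=set0).
Implicit Types (u v w x y z n m p q a : R * R) (r s t e l c : R).
Local Notation D := (dist_to C).
Context (eps : R) (eps0 : 0 < eps)
  (noncritical : forall y, D y = eps -> ~ critical C y).
Local Notation X := (parallel_cocomplement C eps).

Let XE : X = [set y | eps <= D y] := parallel_cocomplementE cC C0 noncritical.

(** For the normalized direction [u'], the vector [u' + rho *: n] is still tangent: the growth along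
    [u'] compensates the loss along [rho *: n]. Testing [n] against it gives strict negativity. *)
Lemma ascent_direction_normal y u n : D y = eps -> ascent_direction C y u ->
  enorm n = 1 -> normal_cone X y n -> dotp u n < 0.
Proof.
move=> yeps yu n1 nX.
have u0 : 0 < enorm u.
  apply: enorm_gt0 => u0; have [p Cp yp] := dist_to_attained cC C0 y.
  by have := yu p Cp yp; rewrite u0 /dotp /= !mul0r addr0 ltxx.
pose u' := (enorm u)^-1 *: u.
have u'1 : enorm u' = 1.
  by rewrite enormZ gtr0_norm ?invr_gt0// mulVf// gt_eqF.
have yu' : ascent_direction C y u'.
  by move=> p Cp yp; rewrite dotpZl mulr_gt0 ?invr_gt0// yu.
have [rho rho0 g] := ascent_direction_grows cC C0 u'1 yu'.
have nn : dotp n n = 1 by apply/enorm_unit.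
have : dotp (u' + rho *: n) n <= 0.
  apply: nX; apply: (tangent_cone_segment rho0) => t /andP[t0 tr].
  rewrite XE /=.
  have := g y t; rewrite subrr enorm0 (ltW rho0) (ltW t0) (ltW tr) => /(_ isT isT).
  have := dist_to_lipschitz cC C0 (y + t *: u') (y + t *: (u' + rho *: n)).
  have -> : y + t *: u' - (y + t *: (u' + rho *: n)) = - (t * rho) *: n.
    by apply: injective_projections; rewrite /= /GRing.scale /=; ring.
  rewrite enormZ n1 mulr1 normrN gtr0_norm ?mulr_gt0//; lra.
rewrite dotpDl !dotpZl nn mulr1 => h.
have : dotp u n = enorm u * ((enorm u)^-1 * dotp u n).
  by rewrite mulrA mulfV ?gt_eqF// mul1r.
move=> ->; rewrite pmulr_rlt0//; lra.
Qed.

(** The open disc of radius [eps] about [p] contains no point of [X], and a tangent vector with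
    positive component along [p - y] would lead into it. *)
Lemma nearest_normal y p : D y = eps -> C p -> enorm (y - p) = D y ->
  normal_cone X y (eps^-1 *: (p - y)).
Proof.
move=> yeps Cp yp u uT; rewrite leNgt; apply/negP => um.
set m := eps^-1 *: (p - y) in um.
have m1 : enorm m = 1.
  by rewrite enormZ gtr0_norm ?invr_gt0// enormB yp yeps mulVf// gt_eqF.
have u0 : 0 < enorm u.
  by apply: enorm_gt0 => u0; move: um; rewrite u0 /dotp /= !mul0r addr0 ltxx.
case: uT => [u0'|uT]; first by move: u0; rewrite u0' enorm0 ltxx.
pose k := dotp u m / enorm u.
have k0 : 0 < k by rewrite divr_gt0.
(* The solution of [2 * eps * (k - e) = e]: a point [y + h] of [X] in the direction of [u] up to [e]
   then satisfies [e * enorm h <= enorm h ^+ 2], contrary to [enorm h < e]. *)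
pose e := k * (2 * eps) / (1 + 2 * eps).
have eps1 : 0 < 1 + 2 * eps by rewrite addr_gt0// mulr_gt0.
have eps2 : 0 < 2 * eps by rewrite mulr_gt0.
have e0 : 0 < e by exact: divr_gt0 (mulr_gt0 k0 eps2) eps1.
have eE : e * (1 + 2 * eps) = k * (2 * eps) by rewrite /e divfK// gt_eqF.
have [b [bX /andP[by0 bye] bdir]] := uT e e0.
have bp : eps <= enorm (b - p).
  by move: bX; rewrite XE /= => /le_trans -> //; rewrite dist_to_le.
have bpE : b - p = (b - y) - eps *: m.
  rewrite /m scalerA mulfV ?gt_eqF// scale1r.
  by apply: injective_projections => /=; ring.
rewrite {}bpE in bp; clearbody m.
move: (b - y) by0 bye bdir bp => h h0 he hdir hp.
have : dotp ((enorm h)^-1 *: h - (enorm u)^-1 *: u) m >= - e.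
  have := cauchy_schwarz_abs ((enorm h)^-1 *: h - (enorm u)^-1 *: u) m.
  by rewrite m1 mulr1 ler_norml => /andP[+ _]; lra.
rewrite dotpBl !dotpZl [X in _ - X]mulrC -/k => h1.
have h2 : (k - e) * enorm h <= dotp h m.
  rewrite -ler_pdivlMr// mulrC; lra.
have : eps ^+ 2 <= enorm (h - eps *: m) ^+ 2.
  by rewrite ler_pXn2r ?nnegrE ?enorm_ge0// ltW.
have mm : dotp m m = 1 by apply/enorm_unit.
rewrite enorm_sqr !(dotpDl, dotpDr, dotpNl, dotpNr, dotpZl, dotpZr) mm (dotpC m h).
rewrite -enorm_sqr => h3.
have h4 : 2 * eps * ((k - e) * enorm h) <= 2 * eps * dotp h m.
  by rewrite ler_wpM2l// mulr_ge0// ltW.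
have h5 : 2 * eps * ((k - e) * enorm h) = e * enorm h.
  rewrite mulrA; congr (_ * _); lra.
have : enorm h * enorm h < e * enorm h by rewrite ltr_pM2r.
lra.
Qed.

(** Put [m = eps^-1 *: (p - y)]. If [n] differs from [m], then [n - m] is an ascent direction, so
    [dotp (n - m) n < 0]; but this number is [1 - dotp n m > 0]. *)
Lemma unique_nearest_normal y p n : D y = eps -> C p -> enorm (y - p) = D y ->
  (forall q, C q -> enorm (y - q) = D y -> q = p) ->
  enorm n = 1 -> normal_cone X y n -> n = eps^-1 *: (p - y).
Proof.
move=> yeps Cp yp up n1 nX; apply: contrapT => nm.
set m := eps^-1 *: (p - y) in nm.
have m1 : enorm m = 1.
  by rewrite enormZ gtr0_norm ?invr_gt0// enormB yp yeps mulVf// gt_eqF.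
have nn : dotp n n = 1 by apply/enorm_unit.
have mm : dotp m m = 1 by apply/enorm_unit.
have nm1 : dotp n m < 1.
  have : 0 < enorm (n - m) ^+ 2.
    by rewrite exprn_gt0// enorm_gt0// => /eqP; rewrite subr_eq0 => /eqP.
  by rewrite enorm_sqr !(dotpBl, dotpBr) nn mm (dotpC m); lra.
have : dotp (n - m) n < 0.
  apply: (ascent_direction_normal yeps) => // q Cq yq; rewrite (up q Cq yq).
  have -> : y - p = - eps *: m.
    by rewrite /m scalerA mulNr mulfV ?gt_eqF// scaleN1r opprB.
  rewrite dotpZr dotpBl mm mulNr -mulrN mulr_gt0//; lra.
rewrite dotpBl nn (dotpC m); lra.
Qed.

(** The directions to [p] and [q] are distinct normals, so one of them differs from [n]. It is not
    [- n] either, because an ascent direction has negative inner product with all normals. *)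
Lemma several_nearest_curvature y p q n : D y = eps -> C p -> C q -> p <> q ->
  enorm (y - p) = D y -> enorm (y - q) = D y ->
  nor X (y, n) -> principal_curvature X (y, n) = +oo%E.
Proof.
move=> yeps Cp Cq pq yp yq ynX; have [yX /= n1 nX] := ynX.
have nor_nearest w : C w -> enorm (y - w) = D y -> nor X (y, eps^-1 *: (w - y)).
  move=> Cw yw; split => //=; last exact: nearest_normal.
  by rewrite /unit_circle /= enormZ gtr0_norm ?invr_gt0// enormB yw yeps mulVf// gt_eqF.
have /existsNP[u /contrapT yu] := noncritical yeps.
have noN m : nor X (y, m) -> n <> - m.
  move=> [_ /= m1 mX] nm.
  have := ascent_direction_normal yeps yu n1 nX.
  have := ascent_direction_normal yeps yu m1 mX.
  rewrite nm dotpNr; lra.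
have [np|np] := pselect (n = eps^-1 *: (p - y)); last first.
  apply: (arc_principal_curvature ynX (nor_nearest p Cp yp)) => //.
  exact/noN/nor_nearest.
apply: (arc_principal_curvature ynX (nor_nearest q Cq yq)); last exact/noN/nor_nearest.
rewrite np => /(congr1 (fun x => eps *: x + y)).
by rewrite !scalerA mulfV ?gt_eqF// !scale1r !subrK.
Qed.

Let near_set (A : set (R * R)) := [set y | exists2 p, A p & enorm (y - p) <= eps].

Let near_half_closed (g : R * R -> R) (c : R) : continuous g ->
  measurable (near_set (C `&` [set p | g p <= c])) /\
  measurable (near_set (C `&` [set p | c <= g p])).
Proof.
move=> cg; split; apply: closed_measurable_plane; apply: compact_near_closed.
  apply: compact_closedI => //.
  exact: (preimage_closed (fun y _ => cg y) (@closed_le _ c)).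
apply: compact_closedI => //.
exact: (preimage_closed (fun y _ => cg y) (@closed_ge _ c)).
Qed.

Let level := [set y | D y = eps].

Let level_measurable : measurable level.
Proof.
apply: closed_measurable_plane; apply: (preimage_closed _ (@closed_eq _ eps)) => y _.
exact: (lipschitz_enorm_continuous (dist_to_lip cC C0)).
Qed.

Let near_level y p : level y -> C p -> enorm (y - p) <= eps -> enorm (y - p) = D y.
Proof.
move=> yeps Cp h; apply/eqP; rewrite eq_le dist_to_le// andbT.
by move: yeps => /= ->.
Qed.

(** On the level set the points of [C] within [eps] of [y] are its nearest points. Distinct ones
    differ in a coordinate, so [g] will be [fst] and [snd]. *)
Let several (g : R * R -> R) := [set y | exists p q,
  [/\ C p, C q, enorm (y - p) <= eps, enorm (y - q) <= eps & g p < g q]].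

Let several_measurable (g : R * R -> R) : continuous g -> measurable (several g).
Proof.
(* Two rationals separating [g p] from [g q] replace the strict inequality by two closed
   conditions. *)
move=> cg; pose F (a b : rat) := near_set (C `&` [set p | g p <= ratr a]) `&`
  near_set (C `&` [set p | ratr b <= g p]).
have -> : several g = \bigcup_a \bigcup_b [set y | (a < b)%O /\ F a b y].
  apply/seteqP; split => y.
    move=> [p [q [Cp Cq yp yq]]] /rat_in_itvoo[b]; rewrite in_itv /= => /andP[pb bq].
    have [a] := rat_in_itvoo pb; rewrite in_itv /= => /andP[pa ab].
    exists a => //; exists b => //; split; first by rewrite ltr_rat in ab.
    by split; [exists p|exists q] => //; split => //=; exact: ltW.
  move=> [a _ [b _ [ab [[p [Cp /= pa] yp] [q [Cq /= bq] yq]]]]].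
  exists p, q; split => //; rewrite (le_lt_trans pa)// (lt_le_trans _ bq)//.
  by rewrite ltr_rat.
apply: bigcupT_measurable_rat => a; apply: bigcupT_measurable_rat => b.
have [ab|ab] := boolP (a < b)%O.
  rewrite (_ : [set y | _] = F a b); last by apply/seteqP; split => y; [case|split].
  apply: measurableI; first exact: (near_half_closed _ cg).1.
  exact: (near_half_closed _ cg).2.
by rewrite (_ : [set y | _] = set0)//; apply/seteqP; split => // y [].
Qed.

Let cfst : continuous (fst : R * R -> R).
Proof. by move=> y; exact: cvg_fst. Qed.

Let csnd : continuous (snd : R * R -> R).
Proof. by move=> y; exact: cvg_snd. Qed.

(* [S1] and [S2] consist of the points of the level set with one and with several
   nearest points. *)
Lemma noncritical_normals : exists S1 S2 : set (R * R), exists n0 : R * R -> R * R,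
  [/\ measurable S1, measurable S2, S1 `&` S2 = set0, measurable_fun setT n0 &
   forall yn : (R * R) * (R * R), nor X yn ->
     S1 yn.1 /\ yn.2 = n0 yn.1 \/ S2 yn.1 /\ principal_curvature X yn = +oo%E].
Proof.
have /choice[P hP] : forall y, exists p, C p /\ enorm (y - p) = D y.
  by move=> y; have [p Cp yp] := dist_to_attained cC C0 y; exists p.
pose S2 := level `&` (several fst `|` several snd).
have mS2 : measurable S2.
  apply: measurableI => //; apply: measurableU; exact: several_measurable.
have mS1 : measurable (level `\` S2) by exact: measurableD.
have unique y p q : (level `\` S2) y -> C p -> C q -> enorm (y - p) <= eps ->
    enorm (y - q) <= eps -> p = q.
  move=> [yl yS] Cp Cq yp yq; apply: contrapT => pq; apply: yS; split => //.
  have [h|h|h1] := ltgtP p.1 q.1; [by left; exists p, q|by left; exists q, p|].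
  have [h|h|h2] := ltgtP p.2 q.2; [by right; exists p, q|by right; exists q, p|].
  by exfalso; apply: pq; exact: injective_projections.
(* As the nearest point is unique here, [c <= g (P y)] means that some point of [C] with [c <= g]
   lies within [eps] of [y], a closed condition. *)
have mP (g : R * R -> R) : continuous g ->
    measurable_fun (level `\` S2) (fun y => g (P y)).
  move=> cg; apply: (measurability _ (RGenCInfty.measurableE R)).
  move=> _ [_ [c ->] <-].
  rewrite (_ : _ `&` _ = (level `\` S2) `&` near_set (C `&` [set p | c <= g p])).
    by apply: measurableI => //; exact: (near_half_closed _ cg).2.
  apply/seteqP; split => y [yS] /=.
    rewrite in_itv /= andbT => cP; split => //.
    exists (P y); first by split => //; case: (hP y).
    by have [_ ->] := hP y; case: yS => ->.
  move=> [p [Cp cp] yp]; split => //; rewrite in_itv /= andbT.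
  suff -> : P y = p by [].
  have [CP yP] := hP y; apply: (unique y) => //; rewrite yP.
  by case: yS => ->.
pose f (g : R * R -> R) := (fun y => eps^-1 * (g (P y) - g y)) \_ (level `\` S2).
have mf (g : R * R -> R) : continuous g -> measurable_fun setT g ->
    measurable_fun setT (f g).
  move=> cg mg; apply: (measurable_restrictT _ mS1).1.
  apply: measurable_funM; first exact: measurable_cst.
  by apply: measurable_funB; [exact: mP|exact: measurable_funTS].
exists (level `\` S2), S2, (fun y => (f fst y, f snd y)); split => //.
- by rewrite setDKI.
- by apply: measurable_fun_pair; exact: mf.
move=> [y n] yn; have [yX /= n1 nX] := yn.
have yl : D y = eps := boundary_cocomplement cC C0 noncritical yX.
have [yS2|yS2] := pselect (S2 y); [right|left]; split => //.
  have [_ [|]] := yS2 => -[p [q [Cp Cq yp yq pq]]];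
    apply: (several_nearest_curvature (p := p) (q := q)) => //;
    by [exact: near_level|move=> h; move: pq; rewrite h ltxx].
have [CP yP] := hP y.
rewrite /f !patchT ?inE//; apply: (unique_nearest_normal yl CP yP) => // q Cq yq.
by apply: (unique y) => //; rewrite ?yq ?yP yl.
Qed.

End NoncriticalNormals.

(** * Lower integrals *)

Local Open Scope ereal_scope.

(** Once [c = +oo] is set aside, all values are finite and the suprema are treated one at a time by
    subtraction. *)
Lemma ge_ereal_supD (R : realType) (S S' : set (\bar R)) (c : \bar R) :
  S !=set0 -> S' !=set0 -> (forall x, S x -> 0 <= x) -> (forall y, S' y -> 0 <= y) ->
  (forall x y, S x -> S' y -> x + y <= c) -> ereal_sup S + ereal_sup S' <= c.
Proof.
move=> [x0 Sx0] [y0 S'y0] S0 S'0 SS'.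
have [->|cfin] := eqVneq c +oo; first exact: leey.
have coo : c < +oo by rewrite ltey.
have Sc x : S x -> x <= c.
  by move=> Sx; rewrite (le_trans _ (SS' x y0 Sx S'y0))// leeDl// S'0.
have S'c y : S' y -> y <= c.
  by move=> S'y; rewrite (le_trans _ (SS' x0 y Sx0 S'y))// leeDr// S0.
have S'fin : ereal_sup S' \is a fin_num.
  rewrite ge0_fin_numE; first by rewrite (le_lt_trans _ coo)//; exact: ge_ereal_sup.
  by rewrite (le_trans (S'0 _ S'y0))//; exact: ereal_sup_ubound.
rewrite -leeBrDr//; apply: ge_ereal_sup => x Sx.
have xfin : x \is a fin_num.
  by rewrite ge0_fin_numE ?S0// (le_lt_trans (Sc _ Sx)).
rewrite leeBrDr// addeC -leeBrDr//; apply: ge_ereal_sup => y S'y.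
by rewrite leeBrDr// addeC SS'.
Qed.

Local Close Scope ereal_scope.

Section LowerIntegral.
Context d (T : measurableType d) (R : realType).
Local Open Scope ereal_scope.
Import HBNNSimple.
Implicit Types (f g : T -> \bar R) (h : {nnsfun T >-> R}).

(* The library's integral of an arbitrary function, not necessarily measurable,
   is the difference of the lower integrals of its positive and negative parts. *)
Definition lower_integral (mu : set T -> \bar R) f : \bar R :=
  ereal_sup [set sintegral mu h |
    h in [set h : {nnsfun T >-> R} | forall x, (h x)%:E <= f x]].

Lemma integral_lower_integral (mu : set T -> \bar R) (D : set T) f :
  \int[mu]_(x in D) f x =
  lower_integral mu (f \_ D)^\+ - lower_integral mu (f \_ D)^\-.
Proof. by []. Qed.

Context (mu : {measure set T -> \bar R}).

Lemma lower_integral_ubound f h : (forall x, (h x)%:E <= f x) ->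
  sintegral mu h <= lower_integral mu f.
Proof. by move=> hf; apply: ereal_sup_ubound; exists h. Qed.

Lemma le_lower_integral f g : (forall x, f x <= g x) ->
  lower_integral mu f <= lower_integral mu g.
Proof.
move=> fg; apply: ge_ereal_sup => _ [h /= hf <-].
by apply: lower_integral_ubound => x; rewrite (le_trans (hf x)).
Qed.

Lemma lower_integral_ge0 f : (forall x, 0 <= f x) -> 0 <= lower_integral mu f.
Proof.
by move=> f0; rewrite -(sintegral0 mu); exact: (@lower_integral_ubound _ nnsfun0).
Qed.

Lemma lower_integral0 f : (forall x, f x = 0) -> lower_integral mu f = 0.
Proof.
move=> f0; apply/eqP; rewrite eq_le lower_integral_ge0 ?andbT; last first.
  by move=> x; rewrite f0.
apply: ge_ereal_sup => _ [h /= hf <-]; rewrite (eq_sintegral (cst 0%R)) ?sintegral0//.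
move=> x; apply/eqP; rewrite eq_le fun_ge0 andbT.
by have := hf x; rewrite f0 lee_fin.
Qed.

Let simple_nonempty f : (forall x, 0 <= f x) ->
  [set sintegral mu h |
    h in [set h : {nnsfun T >-> R} | forall x, (h x)%:E <= f x]] !=set0.
Proof. by move=> f0; exists (sintegral mu nnsfun0), nnsfun0. Qed.

Let simple_ge0 f (x : \bar R) :
  [set sintegral mu h |
    h in [set h : {nnsfun T >-> R} | forall x, (h x)%:E <= f x]] x -> 0 <= x.
Proof. by move=> [h _ <-]; exact: sintegral_ge0. Qed.

(** Sums of simple minorants are simple minorants, so lower integrals of arbitrary nonnegative
    functions are superadditive. *)
Lemma lower_integralD f g : (forall x, 0 <= f x) -> (forall x, 0 <= g x) ->
  lower_integral mu f + lower_integral mu g <= lower_integral mu (f \+ g).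
Proof.
move=> f0 g0; apply: ge_ereal_supD; try exact: simple_nonempty; try exact: simple_ge0.
move=> _ _ [h /= hf <-] [k /= kg <-]; rewrite -sintegralD.
by apply: (@lower_integral_ubound _ (add_nnsfun h k)) => x; rewrite EFinD leeD.
Qed.

Lemma lower_integral_sum n (f : nat -> T -> \bar R) g :
  (forall i x, 0 <= f i x) -> (forall x, \sum_(i < n) f i x <= g x) ->
  \sum_(i < n) lower_integral mu (f i) <= lower_integral mu g.
Proof.
move=> f0; elim: n g => [|n ih] g fg.
  rewrite big_ord0 lower_integral_ge0// => x.
  by have := fg x; rewrite big_ord0.
rewrite big_ord_recr /=.
apply: le_trans (leeD2r _ (ih (fun x => \sum_(i < n) f i x) (fun=> lexx _))) _.
apply: le_trans (lower_integralD _ _) _ => //.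
  by move=> x; exact: sume_ge0.
by apply: le_lower_integral => x; have := fg x; rewrite big_ord_recr.
Qed.

(** A simple function below [f] keeps its integral when it is set to zero on [N], and then it lies
    below [g]. *)
Lemma le_lower_integral_ae f g (N : set T) : measurable N -> mu N = 0 ->
  (forall x, 0 <= g x) -> (forall x, ~ N x -> f x <= g x) ->
  lower_integral mu f <= lower_integral mu g.
Proof.
move=> mN N0 g0 fg; apply: ge_ereal_sup => _ [h /= hf <-].
have mNC := measurableC mN.
rewrite -integralT_nnsfun (ge0_negligible_integral mN)//; first last.
- by move=> x _; rewrite lee_fin.
- exact/measurable_EFinP.
rewrite setTD integral_nnsfun// mrestrict; apply: lower_integral_ubound => x.
rewrite -mrestrict patchE; case: ifPn => [/set_mem xN|_]; last exact: g0.
by rewrite (le_trans (hf x))// fg.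
Qed.

Lemma eq_integral_ae (D : set T) f g : mu.-negligible [set x | D x /\ f x <> g x] ->
  \int[mu]_(x in D) f x = \int[mu]_(x in D) g x.
Proof.
move=> [N [mN N0 fgN]]; rewrite !integral_lower_integral.
have fgD x : ~ N x -> (f \_ D) x = (g \_ D) x.
  move=> Nx; rewrite !patchE; case: ifP => // /set_mem Dx.
  by apply: contrapT => fgx; apply: Nx; exact: fgN.
congr (_ - _); apply/eqP; rewrite eq_le; apply/andP; split;
  apply: (le_lower_integral_ae mN N0) => // x Nx;
  by rewrite ?funeposE ?funenegE fgD.
Qed.

Lemma sum_restrict_le n (C : nat -> set T) g : trivIset setT C ->
  (forall x, 0 <= g x) -> forall x, \sum_(i < n) (g \_ (C i)) x <= g x.
Proof.
move=> tC g0 x; have [[i Cix]|nC] := pselect (exists i : 'I_n, C i x); last first.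
  rewrite big1// => i _; rewrite patchE ifF//.
  by apply/negP => /set_mem Cix; apply: nC; exists i.
rewrite (bigD1 i)//= big1 ?adde0; first by rewrite patchE; case: ifP.
move=> j ji; rewrite patchE ifF//; apply/negP => /set_mem Cjx.
by move/eqP: ji; apply; apply/val_inj/(tC _ _ I I); exists x.
Qed.

End LowerIntegral.

(** * The Hausdorff measure on Borel sets *)

Section HausdorffMeasure.
Context {R : realType}.
Local Open Scope ereal_scope.
Local Notation T := ((R * R) * (R * R))%type.
Implicit Types (A B X : set T) (delta e c : R).

Lemma ediam_ge0 A : 0 <= ediam A.
Proof. by apply: ereal_sup_ubound; left. Qed.

Lemma ediam0 : ediam (set0 : set T) = 0.
Proof.
apply/eqP; rewrite eq_le ediam_ge0 andbT; apply: ge_ereal_sup => x [->//|].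
by move=> [p [q []]].
Qed.

Lemma le_ediam A B : A `<=` B -> ediam A <= ediam B.
Proof.
move=> AB; apply: le_ereal_sup => x [->|[p [q [Ap Aq ->]]]]; first by left.
by right; exists p, q; split => //; exact: AB.
Qed.

Lemma le_enorm4_ediam A p q : A p -> A q -> (enorm4 (p - q)%R)%:E <= ediam A.
Proof. by move=> Ap Aq; apply: ereal_sup_ubound; right; exists p, q. Qed.

(* With every set measurable, [hausdorff1_pre] is an instance of the library's
   construction [mu_ext] of outer measures. *)
Definition all_measurable : Type := T.
HB.instance Definition _ := Pointed.on all_measurable.
HB.instance Definition _ := @isMeasurable.Build default_measure_display
  all_measurable setT I (fun _ _ => I) (fun _ _ => I).

(** The value [+oo] penalizes covers that use a set of diameter above [delta]. *)
Definition small_ediam delta (A : set all_measurable) : \bar R :=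
  if ediam (A : set T) <= delta%:E then ediam (A : set T) else +oo.

Lemma small_ediam_ge0 delta A : 0 <= small_ediam delta A.
Proof. by rewrite /small_ediam; case: ifP => // _; exact: ediam_ge0. Qed.

Lemma hausdorff1_preE delta A : hausdorff1_pre delta A = mu_ext (small_ediam delta) A.
Proof.
apply/eqP; rewrite eq_le; apply/andP; split; last first.
  apply: le_ereal_inf_tmp => _ [B [AB Bd] <-]; apply: ereal_inf_lbound.
  exists B; first by split.
  by apply: eq_eseriesr => i _; rewrite /small_ediam Bd.
apply: le_ereal_inf_tmp => _ [B [_ AB] <-].
have [Bd|/existsNP[i /negP Bi]] := pselect (forall i, ediam (B i : set T) <= delta%:E).
  apply: ereal_inf_lbound; exists B => //.
  by apply: eq_eseriesr => i _; rewrite /small_ediam Bd.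
rewrite [leRHS](@nneseries_pinfty _ _ _ i) ?leey//.
  by move=> n _; exact: small_ediam_ge0.
by rewrite /small_ediam (negbTE Bi).
Qed.

Lemma le_hausdorff1_pre delta A B : A `<=` B ->
  hausdorff1_pre delta A <= hausdorff1_pre delta B.
Proof. by rewrite !hausdorff1_preE => AB; exact: (le_mu_ext (small_ediam delta)). Qed.

Lemma hausdorff1_pre_ge0 delta A : 0 <= hausdorff1_pre delta A.
Proof. by rewrite hausdorff1_preE; apply: mu_ext_ge0 => B; exact: small_ediam_ge0. Qed.

Lemma hausdorff1_pre_anti delta delta' A : (delta <= delta')%R ->
  hausdorff1_pre delta' A <= hausdorff1_pre delta A.
Proof.
move=> dd; apply: le_ereal_inf_tmp => _ [B [AB Bd] <-]; apply: ereal_inf_lbound.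
by exists B => //; split => // i; rewrite (le_trans (Bd i))// lee_fin.
Qed.

Lemma hausdorff1_pre_le delta A : (0 < delta)%R ->
  hausdorff1_pre delta A <= hausdorff1 A.
Proof. by move=> d0; apply: ereal_sup_ubound; exists delta. Qed.

Let hausdorff1_0 : hausdorff1 (set0 : set T) = 0.
Proof.
apply/eqP; rewrite eq_le; apply/andP; split; last first.
  by rewrite (le_trans (hausdorff1_pre_ge0 1 set0))// hausdorff1_pre_le.
apply: ge_ereal_sup => _ [delta /= d0 <-]; rewrite hausdorff1_preE mu_ext0//.
  by rewrite /small_ediam ediam0 lee_fin ltW.
by move=> B; exact: small_ediam_ge0.
Qed.

Let hausdorff1_ge0 A : 0 <= hausdorff1 A.
Proof.
by rewrite (le_trans (hausdorff1_pre_ge0 1 A))// hausdorff1_pre_le.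
Qed.

Let le_hausdorff1 : {homo @hausdorff1 R : A B / A `<=` B >-> A <= B}.
Proof.
move=> A B AB; apply: ge_ereal_sup => _ [delta /= d0 <-].
by rewrite (le_trans (le_hausdorff1_pre _ AB))// hausdorff1_pre_le.
Qed.

Let hausdorff1_sigma_subadditive : sigma_subadditive (@hausdorff1 R).
Proof.
move=> F; apply: ge_ereal_sup => _ [delta /= d0 <-].
rewrite hausdorff1_preE.
apply: le_trans (@mu_ext_sigma_subadditive _ all_measurable R (small_ediam delta)
  (small_ediam_ge0 delta) F) _.
apply: lee_nneseries => i _.
  by move=> _; apply: mu_ext_ge0; exact: small_ediam_ge0.
by rewrite -hausdorff1_preE hausdorff1_pre_le.
Qed.

HB.instance Definition _ := isOuterMeasure.Build R T (@hausdorff1 R)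
  hausdorff1_0 hausdorff1_ge0 le_hausdorff1 hausdorff1_sigma_subadditive.

(** No set of diameter at most [delta] meets both [A] and [B], so a cover of the union splits into a
    cover of each. *)
Lemma hausdorff1_pre_separated delta e A B : (delta < e)%R ->
  (forall p q, A p -> B q -> e <= enorm4 (p - q))%R ->
  hausdorff1_pre delta A + hausdorff1_pre delta B <= hausdorff1_pre delta (A `|` B).
Proof.
move=> de AB; apply: le_ereal_inf_tmp => _ [U [ABU Ud] <-].
pose V (A : set T) i := if pselect (U i `&` A !=set0) then U i else set0.
have VU A' i : V A' i `<=` U i.
  by rewrite /V; case: pselect => /= ?; [exact: subset_refl|exact: sub0set].
have V_le (A' : set T) : A' `<=` A `|` B ->
    hausdorff1_pre delta A' <= \sum_(i <oo) ediam (V A' i).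
  move=> A'AB; apply: ereal_inf_lbound; exists (V A') => //; split.
    move=> p A'p; have [i _ Uip] := ABU p (A'AB p A'p).
    exists i => //; rewrite /V; case: pselect => // h.
    by exfalso; apply: h; exists p.
  by move=> i; rewrite (le_trans (le_ediam (VU A' i))).
apply: (@le_trans _ _ (\sum_(i <oo) (ediam (V A i) + ediam (V B i)))).
  rewrite nneseriesD; [|by move=> *; exact: ediam_ge0..].
  by apply: leeD; apply: V_le; [exact: subsetUl|exact: subsetUr].
apply: lee_nneseries => i _; first by move=> _; rewrite adde_ge0// ediam_ge0.
rewrite /V; case: pselect => [[p [Up Ap]]|nA]; last first.
  by rewrite ediam0 add0e; case: pselect => // nB; rewrite ediam0 ediam_ge0.
case: pselect => [[q [Uq Bq]]|nB]; last by rewrite ediam0 adde0.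
have := le_trans (le_enorm4_ediam Up Uq) (Ud i); rewrite lee_fin.
by rewrite leNgt (lt_le_trans de (AB p q Ap Bq)).
Qed.

Lemma hausdorff1_separated e A B : (0 < e)%R ->
  (forall p q, A p -> B q -> e <= enorm4 (p - q))%R ->
  hausdorff1 A + hausdorff1 B <= hausdorff1 (A `|` B).
Proof.
move=> e0 AB.
have pre d1 d2 : (0 < d1)%R -> (0 < d2)%R ->
    hausdorff1_pre d1 A + hausdorff1_pre d2 B <= hausdorff1 (A `|` B).
  (* The pre-measures increase as [delta] decreases, so a common value below [e] replaces [d1] and
     [d2]. *)
  move=> d10 d20; pose d : R := Num.min d1 (Num.min d2 (e / 2))%R.
  have d0 : (0 < d)%R by rewrite !lt_min d10 d20 divr_gt0.
  have dd1 : (d <= d1)%R by rewrite ge_min lexx.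
  have dd2 : (d <= d2)%R by rewrite !ge_min lexx orbT.
  have de : (d < e)%R.
    by rewrite !gt_min (_ : (e / 2 < e)%R) ?orbT//; lra.
  rewrite (le_trans (leeD (hausdorff1_pre_anti _ dd1) (hausdorff1_pre_anti _ dd2)))//.
  rewrite (le_trans (hausdorff1_pre_separated de AB))//.
  exact: hausdorff1_pre_le.
apply: ge_ereal_supD; first by exists (hausdorff1_pre 1 A), 1%R => //=.
- by exists (hausdorff1_pre 1 B), 1%R => //=.
- by move=> _ [delta _ <-]; exact: hausdorff1_pre_ge0.
- by move=> _ [delta _ <-]; exact: hausdorff1_pre_ge0.
by move=> _ _ [d1 /= d10 <-] [d2 /= d20 <-]; exact: pre.
Qed.

(* The layers [c - 1/(k+1) < g <= c - 1/(k+2)] of one parity are pairwise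
   separated, hence their measures are summable and have small tails. *)
Lemma sublevel_caratheodory (g : T -> R) c :
  (forall p q, (`|g p - g q| <= enorm4 (p - q))%R) ->
  (@hausdorff1 R).-caratheodory [set p | (g p < c)%R].
Proof.
move=> lip; apply: le_caratheodory_measurable => X /=.
set H := [set p | _].
have [->|Xfin] := eqVneq (hausdorff1 X) +oo; first exact: leey.
have sep (A B : set T) (a b : R) : (a < b)%R -> A `<=` [set p | (g p <= a)%R] ->
    B `<=` [set p | (b <= g p)%R] ->
    hausdorff1 A + hausdorff1 B <= hausdorff1 (A `|` B).
  move=> ab Aa Bb; apply: (@hausdorff1_separated (b - a)%R); first by rewrite subr_gt0.
  move=> p q /Aa /= pa /Bb /= qb; rewrite (le_trans _ (lip p q))//.
  by rewrite distrC (le_trans _ (ler_norm _))// lerB.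
pose d (k : nat) : R := (c - k.+1%:R^-1)%R.
have d_lt k l : (k < l)%N -> (d k < d l)%R.
  by move=> kl; rewrite /d ltrD2l ltrN2 ltf_pV2 ?posrE ?ltr0n// ltr_nat.
have d_c k : (d k < c)%R by rewrite /d gtrBl invr_gt0 ltr0n.
pose B k := X `&` [set p | (g p <= d k)%R].
pose L (i j : nat) := X `&` [set p | (d (j.*2 + i).+1 < g p <= d (j.*2 + i).+2)%R].
have hB k : hausdorff1 (B k) + hausdorff1 (X `&` ~` H) <= hausdorff1 X.
  apply: (@le_trans _ _ (hausdorff1 (B k `|` (X `&` ~` H)))).
    apply: (sep _ _ (d k) c) => //; first by move=> p [].
    by move=> p [_ /negP]; rewrite -leNgt.
  by apply: le_outer_measure => p [[]|[]].
(* The layer added last lies above [d (n.*2 + i).+1] and the earlier ones below [d (n.*2 + i)], so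
   that [sep] applies. *)
have hL i n : \sum_(j < n) hausdorff1 (L i j) <= hausdorff1 (B (n.*2 + i)%N).
  elim: n => [|n ih]; first by rewrite big_ord0 outer_measure_ge0.
  rewrite big_ord_recr /=.
  apply: (@le_trans _ _ (hausdorff1 (B (n.*2 + i)%N) + hausdorff1 (L i n))).
    exact: leeD2r.
  apply: (@le_trans _ _ (hausdorff1 (B (n.*2 + i)%N `|` L i n))).
    apply: (sep _ _ (d (n.*2 + i)%N) (d (n.*2 + i).+1)); first exact: d_lt.
      by move=> p [].
    by move=> p [_ /= /andP[/ltW]].
  apply: le_outer_measure => p [[Xp /= h]|[Xp /= /andP[_ h]]]; split => //=.
    by rewrite (le_trans h)// ltW// d_lt// doubleS !addSn ltnW.
have Lfin i : \sum_(j <oo) hausdorff1 (L i j) < +oo.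
  rewrite (@le_lt_trans _ _ (hausdorff1 X)) ?ltey//.
  apply: lime_le; first by apply: is_cvg_nneseries => n _ _; exact: outer_measure_ge0.
  near=> n; rewrite /= big_mkord (le_trans (hL i n))//.
  by apply: le_outer_measure => p [].
have tail i (e : R) : (0 < e)%R ->
    \forall n \near \oo, hausdorff1 (\bigcup_(j in ~` `I_n) L i j) <= e%:E.
  move=> e0.
  have h := nneseries_tail_cvg (Lfin i)
    (fun k _ => outer_measure_ge0 hausdorff1 (L i k)).
  have e0' : (0 : \bar R) < e%:E by rewrite lte_fin.
  have hn : \forall n \near \oo, \sum_(n <= k <oo) hausdorff1 (L i k) < e%:E.
    exact: (h _ (open_ereal_lt' e0')).
  near=> n; apply: (@le_trans _ _ (\sum_(n <= k <oo) hausdorff1 (L i k))).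
    exact: (@outer_measure_sigma_subadditive_tail _ _ (@hausdorff1 R)).
  by apply: ltW; near: n.
apply/lee_addgt0Pr => e e0.
have e20 : (0 < e / 2)%R by rewrite divr_gt0.
have [n [/= t0 t1]] := filter_ex (filterI (tail 0%N _ e20) (tail 1%N _ e20)).
have XH : X `&` H `<=` B n.*2.+1 `|` ((\bigcup_(j in ~` `I_n) L 0%N j) `|`
    (\bigcup_(j in ~` `I_n) L 1%N j)).
  move=> p [Xp /= pc].
  have ex : exists k, (g p <= d k)%R.
    have cp : (0 < c - g p)%R by rewrite subr_gt0.
    exists (Num.truncn (c - g p)^-1); rewrite /d lerBrDr -lerBrDl.
    rewrite -[leRHS]invrK lef_pV2 ?posrE ?invr_gt0 ?ltr0n//.
    by rewrite ltW// truncnS_gt.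
  (* For the least such [k] the point lies in [B n.*2.+1] if [k] is small, and otherwise in the
     layer ending at [d k], whose parity selects the family. *)
  have := ex_minnP ex; case: ex_minnP => k gk kmin _.
  have [kn|kn] := leqP k n.*2.+1.
    left; split => //=; rewrite (le_trans gk)//.
    by move: kn; rewrite leq_eqVlt => /orP[/eqP ->//|/d_lt/ltW].
  case: k gk kmin kn => // -[//|k] gk kmin kn.
  have pk : (d k.+1 < g p)%R.
    by rewrite ltNge; apply/negP => /kmin; rewrite ltnn.
  have nk : (n <= k./2)%N.
    by rewrite -(doubleK n) half_leq.
  have nk' : (~` `I_n) k./2 by apply/negP; rewrite -leqNgt.
  have kE : (k./2.*2 + odd k)%N = k by rewrite addnC odd_double_half.
  right; case: (odd k) kE => kE; [right|left]; exists k./2 => //; split => //=;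
    by rewrite kE pk gk.
apply: (@le_trans _ _ ((hausdorff1 (B n.*2.+1) + (e / 2)%:E + (e / 2)%:E) +
    hausdorff1 (X `&` ~` H))).
  apply: leeD2r; apply: le_trans (le_outer_measure hausdorff1 _ _ XH) _.
  apply: le_trans (outer_measureU2 _ _ _) _; rewrite -addeA leeD2l//.
  set L0 := \bigcup_(j in _) _; set L1 := \bigcup_(j in _) _ in t1 *.
  exact: le_trans (outer_measureU2 (@hausdorff1 R) L0 L1) (leeD t0 t1).
by rewrite -(addeA (hausdorff1 (B n.*2.+1))) -EFinD -splitr addeAC leeD2r.
Unshelve. all: by end_near. Qed.

Lemma enorm4_coord (w : T) : [/\ (`|w.1.1| <= enorm4 w)%R, (`|w.1.2| <= enorm4 w)%R,
  (`|w.2.1| <= enorm4 w)%R & (`|w.2.2| <= enorm4 w)%R].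
Proof. by split; rewrite -sqrtr_sqr ler_wsqrtr// /dotp; nra. Qed.

Local Notation caraT := (caratheodory_type (@hausdorff1 R)).

Lemma lipschitz_caratheodory_measurable (g : T -> R) :
  (forall p q, (`|g p - g q| <= enorm4 (p - q))%R) ->
  measurable_fun setT (g : caraT -> R).
Proof.
move=> lip; apply: (measurability _ (RGenInftyO.measurableE R)).
move=> _ [_ [c ->] <-]; rewrite setTI.
rewrite (_ : _ @^-1` _ = [set p | (g p < c)%R]).
  exact: sublevel_caratheodory.
by apply/seteqP; split => p; rewrite /= in_itv.
Qed.

(** The four coordinates are 1-Lipschitz, hence Caratheodory measurable. The identity, rebuilt from
    them, is then measurable into the product sigma-algebra. *)
Lemma borel_caratheodory A : measurable A -> (@hausdorff1 R).-caratheodory A.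
Proof.
move=> mA.
have mid : measurable_fun setT
    (fun p : caraT => (((p : T).1.1, (p : T).1.2), ((p : T).2.1, (p : T).2.2))).
  apply: measurable_fun_pair; apply: measurable_fun_pair;
    apply: lipschitz_caratheodory_measurable => p q;
    by have [] := enorm4_coord (p - q)%R.
have := mid measurableT A mA; rewrite setTI.
rewrite (_ : _ @^-1` A = A)//.
by apply/seteqP; split => -[[? ?] [? ?]].
Qed.

Let hausdorff1_semi_sigma_additive :
  semi_sigma_additive (@hausdorff1 R : set T -> \bar R).
Proof.
move=> F mF tF mUF.
apply: (@caratheodory_measure_sigma_additive R T (@hausdorff1 R) F) => //.
  by move=> i; exact: borel_caratheodory.
exact: borel_caratheodory.
Qed.

HB.instance Definition _ := isMeasure.Build _ T R (@hausdorff1 R)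
  hausdorff1_0 hausdorff1_ge0 hausdorff1_semi_sigma_additive.

End HausdorffMeasure.

Definition hausdorff1_measure {R : realType} :
  {measure set ((R * R) * (R * R)) -> \bar R} := @hausdorff1 R.

(** * Variation of the projected measure *)

Section Projection.
Context {R : realType}.
Local Open Scope ereal_scope.
Import HBNNSimple.
Local Notation T := ((R * R) * (R * R))%type.
(** Here [N] stands for [nor X], [f] for the weight of the principal curvature and [a] for the
    constant in front of the integral. *)
Context (mu : {measure set T -> \bar R}) (N : set T) (f : T -> \bar R) (a : R)
  (a0 : (a != 0)%R) (Ncircle : N `<=` setT `*` unit_circle).

Local Notation F := (f \_ N).
Local Notation nu := (fun beta : set T =>
  a%:E * \int[mu]_(p in N `&` (reflect_normal @` beta)) f p).
Local Notation J := (lower_integral mu F^\+ + lower_integral mu F^\-).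

Let nuE (beta : set T) :
  a%:E * \int[mu]_(p in N `&` (reflect_normal @` beta)) f p =
  a%:E * (lower_integral mu (F^\+ \_ (reflect_normal @` beta)) -
  lower_integral mu (F^\- \_ (reflect_normal @` beta))).
Proof.
rewrite integral_lower_integral -funepos_restrict -funeneg_restrict.
suff -> : f \_ (N `&` (reflect_normal @` beta)) = F \_ (reflect_normal @` beta) by [].
apply/funext => p; rewrite !patchE in_setI.
by case: (p \in N); case: (p \in _ @` _).
Qed.

Lemma reflect_normalK : involutive (@reflect_normal R).
Proof. by move=> [y n]; rewrite /reflect_normal /= opprK. Qed.

Lemma reflect_normal_cylinder (A : set (R * R)) :
  reflect_normal @` (A `*` unit_circle) = A `*` unit_circle.
Proof.
apply/seteqP; split => [_ [[y n] [/= Ay n1] <-]|[y n] [/= Ay n1]].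
  by split => //=; rewrite /unit_circle /= enormN.
exists (y, - n)%R; last by rewrite /reflect_normal /= opprK.
by split => //=; rewrite /unit_circle /= enormN.
Qed.

Let restrict_pos_ge0 (A : set T) x : 0 <= (F^\+ \_ A) x.
Proof. by apply: erestrict_ge0 => // y _; exact: funepos_ge0. Qed.

Let restrict_neg_ge0 (A : set T) x : 0 <= (F^\- \_ A) x.
Proof. by apply: erestrict_ge0 => // y _; exact: funeneg_ge0. Qed.

(** Superadditivity of lower integrals bounds the sum over disjoint sets, separately for the
    positive and the negative part. *)
Lemma total_variation_ubound Z : Defs.total_variation nu Z <= `|a|%:E * J.
Proof.
apply: ge_ereal_sup => _ [n [B [_ _ tB ->]]].
pose C i := reflect_normal @` (B i).
have tC : trivIset setT C.
  move=> i j _ _ [p [[q Bq <-] [q' Bq' /(can_inj reflect_normalK) qq']]].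
  by apply: tB => //; exists q; split => //; rewrite -qq'.
apply: (@le_trans _ _ (\sum_(i < n) `|a|%:E * (lower_integral mu (F^\+ \_ (C i)) +
    lower_integral mu (F^\- \_ (C i))))).
  apply: lee_sum => i _; rewrite /= nuE abseM; apply: lee_wpmul2l => //.
  apply: (le_trans (lee_abs_sub _ _)).
  by rewrite !gee0_abs// lower_integral_ge0.
rewrite -ge0_sume_distrr; last first.
  by move=> i _; rewrite adde_ge0// lower_integral_ge0.
rewrite big_split /=; apply: lee_wpmul2l => //.
apply: leeD.
  apply: (@lower_integral_sum _ _ _ mu n (fun i => F^\+ \_ (C i))) => //.
  by apply: sum_restrict_le => // x; exact: funepos_ge0.
apply: (@lower_integral_sum _ _ _ mu n (fun i => F^\- \_ (C i))) => //.
by apply: sum_restrict_le => // x; exact: funeneg_ge0.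
Qed.

(* Approximating the positive and the negative part of the density from below by
   simple functions makes it unnecessary to know that the density is measurable. *)
Lemma total_variation_projection_ge :
  (forall h k : {nnsfun T >-> R},
    (forall x, (h x)%:E <= F^\+ x) -> (forall x, (k x)%:E <= F^\- x) ->
    exists A B : set (R * R), [/\ measurable A, measurable B, A `&` B = set0 &
     [/\ forall p, A p.1 -> 0 <= F p, forall p, B p.1 -> F p <= 0,
      forall p, (0 < h p)%R -> A p.1 & forall p, (0 < k p)%R -> B p.1]]) ->
  `|a|%:E * J <= Defs.total_variation (fun A => nu (A `*` unit_circle)) setT.
Proof.
move=> sep; have na0 : (0 < `|a|)%R by rewrite normr_gt0.
rewrite -lee_pdivlMl//.
apply: ge_ereal_supD.
- by exists (sintegral mu nnsfun0), nnsfun0 => // x; exact: funepos_ge0.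
- by exists (sintegral mu nnsfun0), nnsfun0 => // x; exact: funeneg_ge0.
- by move=> _ [h _ <-]; exact: sintegral_ge0.
- by move=> _ [h _ <-]; exact: sintegral_ge0.
move=> _ _ [h /= hF <-] [k /= kF <-].
have [A [B [mA mB AB [FA FB hA kB]]]] := sep h k hF kF.
rewrite lee_pdivlMl//.
have circ p : F p != 0 -> unit_circle p.2.
  rewrite patchE; case: ifPn => [/set_mem /Ncircle[]//|_]; by rewrite eqxx.
(* Over [A] the negative part of the density vanishes, and its positive part dominates [h], which is
   zero off the cylinder. *)
have nuA : `|a|%:E * sintegral mu h <= `|nu (A `*` unit_circle)|.
  rewrite /= nuE reflect_normal_cylinder abseM; apply: lee_wpmul2l => //.
  rewrite [X in _ - X]lower_integral0; last first.
    move=> p; rewrite patchE; case: ifPn => // /set_mem[Ap _].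
    by rewrite funenegE; apply/max_idPr; rewrite leeNl oppe0 FA.
  rewrite sube0 (le_trans _ (lee_abs _))//; apply: lower_integral_ubound => p.
  rewrite patchE; case: ifPn => [_|pA]; first exact: hF.
  rewrite lee_fin leNgt; apply/negP => hp; move/negP: pA; apply; apply/mem_set.
  split; first exact: hA.
  apply: circ; apply/eqP => Fp0; have := hF p.
  by rewrite funeposE Fp0 maxxx leNgt lte_fin hp.
have nuB : `|a|%:E * sintegral mu k <= `|nu (B `*` unit_circle)|.
  rewrite /= nuE reflect_normal_cylinder abseM; apply: lee_wpmul2l => //.
  rewrite [X in X - _]lower_integral0; last first.
    move=> p; rewrite patchE; case: ifPn => // /set_mem[Bp _].
    by rewrite funeposE; apply/max_idPr; rewrite FB.
  rewrite sub0e abseN (le_trans _ (lee_abs _))//; apply: lower_integral_ubound => p.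
  rewrite patchE; case: ifPn => [_|pA]; first exact: kF.
  rewrite lee_fin leNgt; apply/negP => hp; move/negP: pA; apply; apply/mem_set.
  split; first exact: kB.
  apply: circ; apply/eqP => Fp0; have := kF p.
  by rewrite funenegE Fp0 oppe0 maxxx leNgt lte_fin hp.
rewrite ge0_muleDr ?sintegral_ge0//.
apply: (le_trans (leeD nuA nuB)); apply: ereal_sup_ubound.
exists 2%N, (bigcup2 A B); split.
- by move=> [|[|i]] /=.
- by [].
- apply/trivIsetP => -[|[|i]] [|[|j]] _ _ //=; rewrite ?set0I ?setI0//.
  by rewrite setIC.
- by rewrite !big_ord_recl big_ord0 adde0.
Qed.

Lemma total_variation_projection_le :
  Defs.total_variation (fun A => nu (A `*` unit_circle)) setT <=
  Defs.total_variation nu (setT `*` unit_circle).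
Proof.
apply: ge_ereal_sup => _ [n [B [mB _ tB ->]]]; apply: ereal_sup_ubound.
exists n, (fun i => B i `*` unit_circle); split => //.
- by move=> i; apply: measurableX => //; exact: unit_circle_measurable.
- by move=> i p [].
- by move=> i j _ _ [p [[pi _] [pj _]]]; apply: tB => //; exists p.1.
Qed.

End Projection.

(** * Equality of the two variations for each index *)

Section Variations.
Context {R : realType}.
Local Open Scope ereal_scope.
Import HBNNSimple.
Implicit Types (F X : set (R * R)) (eps : R).

Let curv_dir0E F eps : curv_dir 0 F eps = fun beta => (- (2 * pi)^-1)%:E *
  \int[hausdorff1_measure]_(p in nor (parallel_cocomplement F eps) `&`
    (reflect_normal @` beta))
    (weight0 (principal_curvature (parallel_cocomplement F eps) p))%:E.
Proof. by apply/funext => beta; rewrite /curv_dir /= expr1 muleA -EFinM mulN1r. Qed.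

Let curv_dir1E F eps : curv_dir 1 F eps = fun beta => (2^-1)%:E *
  \int[hausdorff1_measure]_(p in nor (parallel_cocomplement F eps) `&`
    (reflect_normal @` beta))
    (weight1 (principal_curvature (parallel_cocomplement F eps) p))%:E.
Proof. by apply/funext => beta; rewrite /curv_dir /= expr0 mul1e. Qed.

Let nor_circle X : nor X `<=` setT `*` unit_circle.
Proof. by move=> p [_ p1 _]. Qed.

Lemma curv_dir_var1 F eps : curv_dir_var 1 F eps = curv_var 1 F eps.
Proof.
rewrite /curv_var /curv /curv_dir_var /= curv_dir1E.
set X := parallel_cocomplement F eps.
apply/eqP; rewrite eq_le total_variation_projection_le andbT.
apply: le_trans (total_variation_ubound _ _ _ _ _) _.
apply: total_variation_projection_ge => //.
(* The weight is nonnegative, so the negative part and [k] vanish. *)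
move=> h k hF kF; exists setT, set0.
have F0 p : 0 <= ((fun p => (weight1 (principal_curvature X p))%:E) \_ (nor X)) p.
  apply: erestrict_ge0 => // q _; rewrite lee_fin /weight1.
  by case: principal_curvature => // r; rewrite invr_ge0 sqrtr_ge0.
split => //; first by rewrite setI0.
split => // p; rewrite ltNge; apply: contraNP => _; rewrite -lee_fin.
rewrite (le_trans (kF p))// funenegE; rewrite ge_max lexx andbT leeNl oppe0.
exact: F0.
Qed.

(** In place of the sets of points over which the density is positive or negative, measurable sets
    are read off from the simple minorants [h] and [k]. *)
Lemma curv_dir_var0 F eps (S1 S2 : set (R * R)) (n0 : R * R -> R * R) :
  measurable S1 -> measurable S2 -> S1 `&` S2 = set0 -> measurable_fun setT n0 ->
  (forall yn, nor (parallel_cocomplement F eps) yn -> S1 yn.1 /\ yn.2 = n0 yn.1 \/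
    S2 yn.1 /\ principal_curvature (parallel_cocomplement F eps) yn = +oo) ->
  curv_dir_var 0 F eps = curv_var 0 F eps.
Proof.
move=> mS1 mS2 S12 mn0.
rewrite /curv_var /curv /curv_dir_var /= curv_dir0E.
set X := parallel_cocomplement F eps => norX.
apply/eqP; rewrite eq_le total_variation_projection_le andbT.
apply: le_trans (total_variation_ubound _ _ _ _ _) _.
apply: total_variation_projection_ge => //.
  by rewrite oppr_eq0 invr_eq0 mulf_neq0 ?pnatr_eq0// gt_eqF// pi_gt0.
set f := (fun p => _) \_ _ => h k hF kF.
have fN p : f p != 0 -> nor X p.
  by rewrite /f patchE; case: ifPn => [/set_mem//|]; rewrite eqxx.
have notS12 y : S1 y -> S2 y -> False.
  by move=> y1 y2; have : (S1 `&` S2) y by []; rewrite S12.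
have f2 p : S2 p.1 -> 0 <= f p.
  move=> p2; rewrite /f patchE; case: ifPn => // /set_mem /norX[[p1 _]|[_ ->]].
    by exfalso; exact: notS12 p2.
  by rewrite /weight0 lee_fin.
have f1 p : S1 p.1 -> f p != 0 -> p.2 = n0 p.1.
  by move=> p1 /fN/norX[[]//|[p2 _]]; exfalso; exact: notS12 p2.
have fS p : f p != 0 -> S1 p.1 \/ S2 p.1.
  by move=> /fN/norX[[]|[]]; [left|right].
have hf p : (0 < h p)%R -> 0 < f p.
  move=> hp; have := hF p; rewrite funeposE le_max => /orP[|]; last first.
    by rewrite lee_fin leNgt hp.
  by apply: lt_le_trans; rewrite lte_fin.
have kf p : (0 < k p)%R -> f p < 0.
  move=> kp; have := kF p; rewrite funenegE le_max => /orP[|]; last first.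
    by rewrite lee_fin leNgt kp.
  by rewrite leeNr => /le_lt_trans; apply; rewrite lte_fin oppr_lt0.
(* Over a point [y] of [S1] the only possible normal is [n0 y], so one value of the simple function
   decides the sign of the density over [y]. *)
pose sec (g : {nnsfun ((R * R) * (R * R)) >-> R}) :=
  [set y | (0 < g (y, n0 y))%R].
have msec g : measurable (sec g).
  have mg : measurable_fun setT (fun y : R * R => g (y, n0 y)).
    apply: (measurableT_comp (f := g)) => //.
    by apply: measurable_fun_pair => //; exact: measurable_id.
  have := mg measurableT `]0%R, +oo[%classic (measurable_itv _).
  rewrite setTI (_ : _ @^-1` _ = sec g)//.
  by apply/seteqP; split => y; rewrite /sec /= in_itv /= andbT.
have pE (p : (R * R) * (R * R)) : p = (p.1, p.2) by case: p.
(* Over [S2] the weight is 1 on the normals, so all of [S2] may join the nonnegative side, and [k]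
   vanishes over it. *)
exists ((S1 `&` sec h) `|` S2), (S1 `&` sec k); split.
- by apply: measurableU => //; exact: measurableI.
- exact: measurableI.
- apply/seteqP; split => // y [[[_ hy]|y2] [y1 ky]]; last by have := notS12 _ y1 y2.
  by have := lt_trans (kf _ ky) (hf _ hy); rewrite ltxx.
split.
- move=> p [[p1 hp]|]; last exact: f2.
  have [->//|/(f1 _ p1) pn] := eqVneq (f p) 0.
  by rewrite (pE p) pn; apply/ltW/hf.
- move=> p [p1 kp]; have [->//|/(f1 _ p1) pn] := eqVneq (f p) 0.
  by rewrite (pE p) pn; apply/ltW/kf.
- move=> p hp; have fp := hf p hp; have fp0 : f p != 0 by rewrite gt_eqF.
  have [p1|] := fS p fp0; last by right.
  by left; split => //; rewrite /sec /= -(f1 _ p1 fp0) -pE.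
- move=> p kp; have fp := kf p kp; have fp0 : f p != 0 by rewrite lt_eqF.
  have [p1|p2] := fS p fp0; last by have := f2 p p2; rewrite leNgt fp.
  by split => //; rewrite /sec /= -(f1 _ p1 fp0) -pE.
Qed.

Lemma curv_dir_var2 F eps : measurable (parallel_set F eps) ->
  curv_dir_var 2 F eps = curv_var 2 F eps.
Proof.
move=> mF; rewrite /curv_dir_var /curv_var /=.
have curvE A : curv 2 F eps A = lebesgue2 (parallel_set F eps `&` A).
  rewrite /curv /curv_dir /=; congr (lebesgue2 (_ `&` _)).
  apply/seteqP; split => [_ [p [Ap _] <-]//|y Ay].
  (* Any unit vector shows that the cylinder over [A] projects onto [A]. *)
  exists (y, (1%R, 0%R)) => //; split => //=.
  by rewrite /unit_circle /= /enorm /dotp /= mul1r mul0r addr0 sqrtr1.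
apply/eqP; rewrite eq_le; apply/andP; split.
  apply: ereal_sup_ubound; exists 1%N, (bigcup2 setT set0); split => //.
  - by move=> [|[|i]] /=.
  - by apply/trivIsetP => -[|[|i]] [|[|j]] _ _ //=; rewrite ?set0I ?setI0.
  - by rewrite big_ord_recl big_ord0 adde0 /= curvE setIT gee0_abs// measure_ge0.
apply: ge_ereal_sup => _ [n [B [mB _ tB ->]]].
under eq_bigr do rewrite curvE gee0_abs ?measure_ge0//.
have mFB i : measurable (parallel_set F eps `&` B i) by exact: measurableI.
have tFB : trivIset setT (fun i => parallel_set F eps `&` B i).
  by move=> i j _ _ [x [[_ xi] [_ xj]]]; apply: tB => //; exists x.
have mU : measurable (\big[setU/set0]_(i < n) (parallel_set F eps `&` B i)).
  by apply: bigsetU_measurable => i _; exact: mFB.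
rewrite /lebesgue2 -(@measure_semi_additive_ord_I _ _ _
  (lebesgue_measure \x lebesgue_measure) (fun i => parallel_set F eps `&` B i))//.
- apply: le_measure; rewrite ?inE//.
  by elim/big_ind : _ => // X Y XF YF; rewrite subUset.
- by move=> i _; exact: mFB.
- exact: sub_trivIset tFB.
Qed.

End Variations.

(** * Exponents *)

(** The exceptional set [N] is added to the null set that the essential limit discards. *)
Lemma ess_cvg_right0_ae (R : realType) (N : set R) (f g : R -> \bar R) (l : \bar R) :
  lebesgue_measure.-negligible N -> (forall x, 0 < x -> ~ N x -> f x = g x) ->
  ess_cvg_right0 f l -> ess_cvg_right0 g l.
Proof.
move=> nN fg [M nM fl]; exists (M `|` N); first exact: negligibleU.
move=> A lA; have := fl A lA; rewrite /nbhs /= /within /=.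
move=> h; near=> x => xMN; rewrite -fg//.
- have : (~` M) x -> A (f x) by near: x.
  by apply=> Mx; apply: xMN; left.
- by move=> Nx; apply: xMN; right.
Unshelve. all: by end_near. Qed.

Lemma s_exponent_ae (R : realType) (N : set R) k (V W : R -> \bar R) :
  lebesgue_measure.-negligible N -> (forall x, 0 < x -> ~ N x -> V x = W x) ->
  s_exponent k V = s_exponent k W.
Proof.
move=> nN VW; congr ereal_inf; apply/seteqP; split => _ [s [s0 h] <-];
  exists s => //; split => //; apply: (ess_cvg_right0_ae nN _ h) => x x0 Nx;
  by rewrite VW.
Qed.

Lemma a_exponent_ae (R : realType) (N : set R) k (D : set R) (V W : R -> \bar R) :
  D `<=` [set x | 0 < x] ->
  lebesgue_measure.-negligible N -> (forall x, 0 < x -> ~ N x -> V x = W x) ->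
  a_exponent k D V = a_exponent k D W.
Proof.
move=> D0 nN VW; congr ereal_inf.
have E (s : R) : (fun delta : R => (`|ln delta|^-1)%:E *
    \int[lebesgue_measure]_(eps in `[delta, 1%R] `&` D)
      ((eps `^ (s - k%:R - 1))%:E * V eps))%E =
  (fun delta : R => (`|ln delta|^-1)%:E *
    \int[lebesgue_measure]_(eps in `[delta, 1%R] `&` D)
      ((eps `^ (s - k%:R - 1))%:E * W eps))%E.
  apply/funext => delta; congr (_ * _)%E; apply: eq_integral_ae.
  apply: negligibleS nN => x [[_ Dx] h]; apply: contrapT => Nx; apply: h.
  by rewrite VW//; exact: D0.
by apply/seteqP; split => _ [s [s0 h] <-]; exists s => //; split => //; rewrite ?E// -E.
Qed.

(** * Passage to the closure of [F], and conclusion *)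

Lemma parallel_set_closure (R : realType) (F : set (R * R)) (eps : R) :
  F !=set0 -> compact (closure F) -> parallel_set F eps = parallel_set (closure F) eps.
Proof.
move=> F0 cF; have cF0 : closure F !=set0.
  by case: F0 => p Fp; exists p; exact: subset_closure.
suff E y : edist_set y F = edist_set y (closure F).
  by apply/seteqP; split => y; rewrite /parallel_set /= E.
apply/eqP; rewrite eq_le; apply/andP; split; last first.
  apply: le_ereal_inf_tmp => _ [p Fp <-]; apply: ereal_inf_lbound.
  by exists p => //; exact: subset_closure.
rewrite (edist_setE cF cF0); have [p pF <-] := dist_to_attained cF cF0 y.
apply/lee_addgt0Pr => e e0; have [q Fq qp] := (closure_enormP _ _).1 pF e e0.
apply: (@le_trans _ _ (enorm (y - q))%:E).
  by apply: ereal_inf_lbound; exists q.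
rewrite -EFinD lee_fin (le_trans (enorm_triangle y p q))// lerD2l enormB.
exact: ltW.
Qed.

Lemma eq_parallel_set (R : realType) (F G : set (R * R)) :
  (forall eps : R, parallel_set F eps = parallel_set G eps) ->
  [/\ regular_value F = regular_value G,
      forall k, curv_dir k F = curv_dir k G &
      forall k, curv_dir_var k F = curv_dir_var k G].
Proof.
move=> FG.
have cFG eps : parallel_cocomplement F eps = parallel_cocomplement G eps.
  by rewrite /parallel_cocomplement FG.
have dFG k : curv_dir k F = curv_dir k G.
  by apply/funext => eps; apply/funext => beta; rewrite /curv_dir cFG FG.
split; [|exact: dFG|].
  by apply/funext => eps; rewrite /regular_value cFG FG.
by move=> k; apply/funext => eps; rewrite /curv_dir_var dFG FG.
Qed.

Lemma regular_curv_var_ae (R : realType) (F : set (R * R)) (hF : bounded_set F) :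
  exists2 N : set R, lebesgue_measure.-negligible N &
    forall eps, 0 < eps -> ~ N eps -> regular_value F eps /\
      forall k, (k < 3)%N -> curv_dir_var k F eps = curv_var k F eps.
Proof.
have split3 (P : nat -> Prop) : P 0%N -> P 1%N -> P 2%N -> forall k, (k < 3)%N -> P k.
  by move=> ? ? ? [|[|[|]]].
have [F0|F0] := pselect (F !=set0); last first.
  (* For empty [F] the distance is [+oo]: the parallel sets are empty, the cocomplement is the whole
     plane, and there are no normals. *)
  exists set0; first exact: negligible_set0.
  move=> eps eps0 _.
  have P0 : parallel_set F eps = set0.
    apply/seteqP; split => // y; rewrite /parallel_set /= /edist_set.
    rewrite (_ : [set _ | x in F] = set0) ?ereal_inf0//.
    by apply/seteqP; split => // _ [x Fx <-]; apply: F0; exists x.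
  have X0 : parallel_cocomplement F eps = setT.
    by rewrite /parallel_cocomplement P0 setC0 closureT.
  split.
    split => //.
      rewrite X0; split; first exact: closedT.
      apply: (@lt_le_trans _ _ 1%:E); first by rewrite lte_fin.
      apply: le_ereal_inf_tmp => _ [a _ <-]; apply: ereal_sup_ubound.
      exists 1 => //; split => // y _; exists y; split.
        by split => // z _; rewrite subrr enorm0 enorm_ge0.
      move=> x [_ /(_ y I)]; rewrite subrr enorm0 => h.
      have /enorm_eq0/eqP : enorm (y - x) = 0 by apply/eqP; rewrite eq_le h enorm_ge0.
      by rewrite subr_eq0 => /eqP.
    by move=> p; rewrite P0 /boundary closure0 => -[].
  have nor0 p : ~ nor (parallel_cocomplement F eps) p.
    by move=> [[_ +] _ _]; rewrite X0 interiorT; apply.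
  apply: split3; [|exact: curv_dir_var1|apply: curv_dir_var2; rewrite P0//].
  by apply: (@curv_dir_var0 _ _ _ set0 set0 id) => //; rewrite ?setI0// => p /nor0.
have [r Fr] := bounded_set_enorm hF.
have cC : compact (closure F).
  apply: (@enorm_closed_bounded_compact _ _ (r + 1)); first exact: closed_closure.
  move=> y /closure_enormP /(_ 1 ltr01)[z Fz zy].
  have := enormBD z (z - y); rewrite opprB addrC subrK.
  have := Fr z Fz; lra.
have C0 : closure F !=set0 by case: F0 => p Fp; exists p; exact: subset_closure.
have FC eps : parallel_set F eps = parallel_set (closure F) eps.
  exact: parallel_set_closure.
have [regE dirE dirvE] := eq_parallel_set FC.
(* The exceptional values are the positive critical values of the distance to the closure. *)
exists [set s | 0 < s /\ exists2 y, critical (closure F) y & dist_to (closure F) y = s].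
  exact: critical_values_negligible.
move=> eps eps0 epsN.
have nc y : dist_to (closure F) y = eps -> ~ critical (closure F) y.
  by move=> yeps cy; apply: epsN; split => //; exists y.
split; first by rewrite regE; exact: noncritical_regular_value.
move=> k k3; rewrite /curv_var /curv dirvE dirE -/(curv_var k (closure F) eps).
move: k k3; apply: split3.
- have [S1 [S2 [n0 [mS1 mS2 S12 mn0 hn0]]]] := noncritical_normals cC C0 eps0 nc.
  exact: curv_dir_var0 hn0.
- exact: curv_dir_var1.
apply: curv_dir_var2; rewrite parallel_setE//; apply: closed_measurable_plane.
rewrite (_ : [set y | _] = [set y | - eps <= - dist_to (closure F) y]).
  apply: (@lipschitz_closed _ _ 1) => p q; rewrite -opprD normrN.
  exact: dist_to_lip.
by apply/seteqP; split => y /=; rewrite lerN2.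
Qed.

Theorem corollary6p3 (R : realType) (F : set (R * R)) (hF : bounded_set F)
    (k : 'I_3) :
  exponents_well_defined k F /\
  s_curv_dir k F = s_curv k F /\
  a_curv_dir k F = a_curv k F.
Proof.
have [N nN h] := regular_curv_var_ae hF.
have dirE (eps : R) : 0 < eps -> ~ N eps -> curv_dir_var k F eps = curv_var k F eps.
  by move=> e0 eN; apply: (h eps e0 eN).2.
split; last split.
- apply: negligibleS nN => eps /= neps; apply: contrapT => eN; apply: neps => e0.
  by split => // _; exact: (h eps e0 eN).1.
- exact: s_exponent_ae dirE.
- apply: a_exponent_ae dirE => //.
  by move=> eps [].
Qed.
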